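(* Let $A$ be a Banach algebra having bounded local units and the strong property $(\mathbb{B})$ with a constant $r$. Let $M$ be a bound for the local units of $A$. Let $n\in\mathbb{N}$, and suppose that $X$ is a Banach $A$-bimodule such that $\mathcal{H}^{n+1}(A,X)$ is a Banach space. Then for each $T\in B^n(A,X)$, $$\operatorname{dist}(T,\mathcal{Z}^n(A,X))\leq C\,2^{n-1}\bigl(M^2r+(M+1)^2\bigr)^{n+1}\operatorname{dist}_r(T,\mathcal{Z}^n(A,X)),$$ where $C$ is a constant satisfying $\operatorname{dist}(T,\mathcal{Z}^n(A,X))\leq C\|\delta^n(T)\|$ for all $T\in B^n(A,X)$.
   Context: A Banach algebra $A$ has the strong property $(\mathbb{B})$ with a constant $r>0$ if for each Banach space $Y$ and every bounded bilinear map $\varphi:A\times A\to Y$, $\|\varphi(ab,c)-\varphi(a,bc)\|\leq r\,\alpha(\varphi)\|a\|\|b\|\|c\|$ for all $a,b,c\in A$, where $\alpha(\varphi)=\sup\{\|\varphi(a,b)\| : a,b\in A,\ \|a\|,\|b\|\leq 1,\ ab=0\}$. $B^n(A,X)$ is the Banach space of bounded $n$-linear maps from $A\times\cdots\times A$ ($n$ copies) to $X$. The connecting map $\delta^n:B^n(A,X)\to B^{n+1}(A,X)$ is $$\delta^nT(a_1,\ldots,a_{n+1})=a_1T(a_2,\ldots,a_{n+1})+\sum_{j=1}^n(-1)^jT(a_1,\ldots,a_ja_{j+1},\ldots,a_{n+1})+(-1)^{n+1}T(a_1,\ldots,a_n)a_{n+1}.$$ $\mathcal{Z}^n(A,X)=\ker\delta^n$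 is the space of bounded $n$-cocycles, and $\mathcal{H}^{n+1}(A,X)=\mathcal{Z}^{n+1}(A,X)/\operatorname{Im}\delta^n$; it is a Banach space (for the quotient seminorm) exactly when $\operatorname{Im}\delta^n$ is closed. For a closed subspace $\mathcal{S}$ of $B^n(A,X)$, $\operatorname{dist}(T,\mathcal{S})=\inf_{S\in\mathcal{S}}\|T-S\|$ and $\operatorname{dist}_r(T,\mathcal{S})=\sup_{\|a_1\|,\ldots,\|a_n\|\leq 1}\inf_{S\in\mathcal{S}}\|T(a_1,\ldots,a_n)-S(a_1,\ldots,a_n)\|$. $A$ has bounded local units with bound $M$ if there is a dense subset $A_0$ of $A$ such that for every $a\in A_0$ there is $e\in A$ with $\|e\|\leq M$ and $ae=ea=a$. *)

(* Defs.v *)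
From HB Require Import structures.
From mathcomp Require Import all_boot all_order all_algebra.
From mathcomp Require Import complex.
From mathcomp Require Import all_classical all_reals all_analysis.

Set Implicit Arguments.
Unset Strict Implicit.
Unset Printing Implicit Defensive.

Import Order.TTheory GRing.Theory Num.Theory.
Import numFieldNormedType.Exports.

Local Open Scope classical_set_scope.
Local Open Scope complex_scope.
Local Open Scope ring_scope.

(* Banach algebras are not assumed unital, so they are not built on top of
   MathComp's (unital) ring structures. *)
HB.mixin Record isBanachAlgebra (K : numFieldType) A
    of CompleteNormedModule K A := {
  bmul : A -> A -> A;
  bmul_bilinear : bilinear_for *:%R *:%R bmul;
  bmulA : associative bmul;
  bmul_norm_le : forall a b : A, `|bmul a b| <= `|a| * `|b|
}.

#[short(type="banachAlgType")]
HB.structure Definition BanachAlgebra (K : numFieldType) :=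
  {A of isBanachAlgebra K A & CompleteNormedModule K A}.

(* The actions are contractive: the usual normalization, under which explicit
   constants in norm estimates do not depend on the norms of the actions. *)
HB.mixin Record isBanachBimodule (K : numFieldType) (A : banachAlgType K) X
    of CompleteNormedModule K X := {
  lact : A -> X -> X;
  ract : X -> A -> X;
  lact_bilinear : bilinear_for *:%R *:%R lact;
  ract_bilinear : bilinear_for *:%R *:%R ract;
  lactA : forall (a b : A) (x : X), lact (bmul a b) x = lact a (lact b x);
  ractA : forall (x : X) (a b : A), ract x (bmul a b) = ract (ract x a) b;
  lract : forall (a : A) (x : X) (b : A),
    ract (lact a x) b = lact a (ract x b);
  lact_norm_le : forall (a : A) (x : X), `|lact a x| <= `|a| * `|x|;
  ract_norm_le : forall (x : X) (a : A), `|ract x a| <= `|x| * `|a|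
}.

#[short(type="banachBimodType")]
HB.structure Definition BanachBimodule (K : numFieldType)
    (A : banachAlgType K) :=
  {X of isBanachBimodule K A X & CompleteNormedModule K X}.

(* Over R[i] the norm `|x| has type R[i] (with zero imaginary part); this is
   the same number in R. *)
Definition rnorm (R : realType) (V : completeNormedModType R[i]) (x : V) : R :=
  complex.Re `|x|.

Section BilinearMaps.
Variables (R : realType) (A : banachAlgType R[i]).

Definition bounded_bilinear (Y : completeNormedModType R[i])
    (phi : A -> A -> Y) : Prop :=
  bilinear_for *:%R *:%R phi /\
  exists c : R, forall a b, rnorm (phi a b) <= c * (rnorm a * rnorm b).

Definition alphaB (Y : completeNormedModType R[i]) (phi : A -> A -> Y) : R :=
  sup [set t | exists a b : A,
    [/\ rnorm a <= 1, rnorm b <= 1, bmul a b = 0 & t = rnorm (phi a b)]].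

Definition strong_property_B (r : R) : Prop :=
  0 < r /\
  forall (Y : completeNormedModType R[i]) (phi : A -> A -> Y),
    bounded_bilinear phi ->
    forall a b c : A,
      rnorm (phi (bmul a b) c - phi a (bmul b c)) <=
        r * alphaB phi * rnorm a * rnorm b * rnorm c.

Definition bounded_local_units (M : R) : Prop :=
  exists A0 : set A, dense A0 /\
    forall a, A0 a ->
      exists e : A, [/\ rnorm e <= M, bmul a e = a & bmul e a = a].

End BilinearMaps.

Section Cochains.
Variables (R : realType) (A : banachAlgType R[i]).
Variable X : banachBimodType A.

Definition bounded_maps (n : nat) : set (('I_n -> A) -> X) :=
  [set T | (forall (i : 'I_n) (a : 'I_n -> A),
              linear (fun x : A => T (dfwith a i x))) /\
           exists c : R, forall a, rnorm (T a) <= c * \prod_i rnorm (a i)].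

Definition unit_ball_pow (n : nat) : set ('I_n -> A) :=
  [set a | forall i, rnorm (a i) <= 1].

Definition opnorm (n : nat) (T : ('I_n -> A) -> X) : R :=
  sup [set rnorm (T a) | a in @unit_ball_pow n].

(* [merge j a] is (a_0, ..., a_j a_{j+1}, ..., a_n), of length n: its k-th
   entry is a_k for k < j and a_{k+1} for k > j. *)
Definition merge (n : nat) (j : 'I_n) (a : 'I_n.+1 -> A) : 'I_n -> A :=
  fun k =>
    if (k < j)%N then a (widen_ord (leqnSn n) k)
    else if k == j then bmul (a (widen_ord (leqnSn n) k)) (a (lift ord0 k))
    else a (lift ord0 k).

(* Indices start at 0, hence the sign (-1)^(j+1) for the product a_j a_{j+1}. *)
Definition connecting (n : nat) (T : ('I_n -> A) -> X) :
    ('I_n.+1 -> A) -> X :=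
  fun a =>
    lact (a ord0) (T (fun k => a (lift ord0 k)))
    + \sum_(j < n) (-1) ^+ j.+1 *: T (merge j a)
    + (-1) ^+ n.+1 *: ract (T (fun k => a (widen_ord (leqnSn n) k))) (a ord_max).

Definition cocycles (n : nat) : set (('I_n -> A) -> X) :=
  [set T | bounded_maps T /\ forall a, connecting T a = 0].

(* Im delta^n, a subset of B^{n+1}(A, X). *)
Definition coboundaries (n : nat) : set (('I_n.+1 -> A) -> X) :=
  [set connecting S | S in @bounded_maps n].

Definition dist (n : nat) (T : ('I_n -> A) -> X)
    (S : set (('I_n -> A) -> X)) : R :=
  inf [set opnorm (T \- s) | s in S].

Definition dist_r (n : nat) (T : ('I_n -> A) -> X)
    (S : set (('I_n -> A) -> X)) : R :=
  sup [set inf [set rnorm (T a - s a) | s in S] | a in @unit_ball_pow n].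

(* The quotient seminorm of the class of T in H^{n+1}(A, X). *)
Definition cohom_seminorm (n : nat) (T : ('I_n.+1 -> A) -> X) : R :=
  dist T (@coboundaries n).

(* H^{n+1}(A, X) = Z^{n+1}(A, X) / Im delta^n is a Banach space: its quotient
   seminorm is a norm, for which it is complete.  Both are stated on
   representatives in Z^{n+1}(A, X). *)
Definition cohomology_banach (n : nat) : Prop :=
  (forall T, @cocycles n.+1 T -> cohom_seminorm T = 0 -> @coboundaries n T) /\
  (forall u : nat -> (('I_n.+1 -> A) -> X),
     (forall k, @cocycles n.+1 (u k)) ->
     (forall e : R, 0 < e -> exists N : nat, forall k l,
        (N <= k)%N -> (N <= l)%N -> cohom_seminorm (u k \- u l) < e) ->
     exists2 T, @cocycles n.+1 T &
       (fun k => cohom_seminorm (u k \- T)) @ \oo --> (0 : R)).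

Definition stability_constant (n : nat) (C : R) : Prop :=
  forall T, @bounded_maps n T ->
    dist T (@cocycles n) <= C * opnorm (connecting T).

End Cochains.

Arguments bounded_local_units {R} A M.
Arguments strong_property_B {R} A r.
Arguments bounded_maps {R A} X n.
Arguments cocycles {R A} X n.
Arguments coboundaries {R A} X n.
Arguments cohomology_banach {R A} X n.
Arguments stability_constant {R A} X n C.

(* Main.v *)
From HB Require Import structures.
Require Import Defs.
From mathcomp Require Import all_boot all_order all_algebra.
From mathcomp Require Import complex.
From mathcomp Require Import all_classical all_reals all_analysis.
From mathcomp Require Import zify ring lra.

Import Order.TTheory GRing.Theory Num.Theory.
Import numFieldNormedType.Exports.

Local Open Scope classical_set_scope.
Local Open Scope complex_scope.
Local Open Scope ring_scope.

(** Write [Z] for the bounded [n]-cocycles, [d] for the connecting map and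
    [K = M ^ 2 r + (M + 1) ^ 2].

    The inequality follows from [||d T|| <= K ^ (n + 1) dist_r(T, Z)]
    ([opnorm_connecting_le_dist_r]), since [dist(T, Z) <= C ||d T||] and
    [2 ^ (n - 1) >= 1].  To prove it, adjoin a unit to [A] and attach to an
    [n]-linear map [T] the function of [n + 2] variables of the unitization
      [amp T (w_0, ..., w_(n+1)) = w_0 . T(w_1, ..., w_n) . w_(n+1)],
    where [T] only sees the components in [A] of [w_1, ..., w_n], so that it
    vanishes when one of them is the unit.  Then [amp (d T)] is the alternating
    sum of the [amp T] of the words obtained by multiplying two neighbouring
    letters ([amp_connecting]): the terms due to the scalar components
    telescope.

    Evaluate [amp (d T)] on the word
      [1, q_0 p_0, q_1 p_1, ..., q_(n+1) p_(n+1)], with [q_0 = p_(n+1) = 1].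
    If every product [p_i q_(i+1)] is zero, only the first of these terms
    survives.  It vanishes for cocycles, so [T] may be replaced there by
    [T - S] with [S] in [Z], and [dist_r(T, Z)] bounds the value
    ([rnorm_amp_gaps]).  The strong property (B) converts an estimate on pairs
    with [p_i q_(i+1) = 0] into one on pairs [(b, 1)] with [b] in [A], at the
    price of a factor [K] ([phi_emb_one]): the value at [(1, b)] is zero, and
    with a local unit [e] of [b] the pairs [(b, 1 - e)] and [(1 - e, b)] have
    zero product.  Once the [n + 1] pairs have been converted, the word is
    [1, b_0, ..., b_n, 1] and the value is [d T (b_0, ..., b_n)].

    The existence of [C] is the open mapping theorem for [d].  A coboundary is
    a cocycle, because the face maps satisfy the simplicial identity
    ([connecting_connecting]); hence a limit of coboundaries is a cocycle at
    distance zero from the coboundaries, hence a coboundary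
    ([coboundary_limit]), and the image of [d] is complete. *)

Set Implicit Arguments.
Unset Strict Implicit.
Unset Printing Implicit Defensive.

(** * Real-valued norms and linear maps *)

Section RealNorm.
Variable R : realType.

Definition cnorm (z : R[i]) : R := complex.Re `|z|.

Lemma cnormE (z : R[i]) : `|z| = (cnorm z)%:C.
Proof. by rewrite /cnorm RRe_real// normr_real. Qed.

Lemma cnorm_ge0 z : 0 <= cnorm z.
Proof. by rewrite -ler0c -cnormE. Qed.

Lemma cnormD z1 z2 : cnorm (z1 + z2) <= cnorm z1 + cnorm z2.
Proof. by rewrite -lecR rmorphD/= -!cnormE ler_normD. Qed.

Lemma cnormM z1 z2 : cnorm (z1 * z2) = cnorm z1 * cnorm z2.
Proof. by apply: complexI; rewrite rmorphM/= -!cnormE normrM. Qed.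

Lemma cnorm_real (t : R) : 0 <= t -> cnorm t%:C = t.
Proof. by move=> t0; rewrite /cnorm ger0_norm ?ler0c. Qed.

Lemma cnorm0 : cnorm 0 = 0.
Proof. by rewrite /cnorm normr0. Qed.

Lemma cnorm1 : cnorm 1 = 1.
Proof. by rewrite /cnorm normr1. Qed.

Lemma cnorm_sign n : cnorm ((-1) ^+ n) = 1.
Proof. by rewrite /cnorm normrX normrN1 expr1n. Qed.

Variable V : completeNormedModType R[i].
Implicit Types x y : V.

Lemma rnormE x : `|x| = (rnorm x)%:C.
Proof. by rewrite /rnorm RRe_real// ger0_real. Qed.

Lemma rnorm_ge0 x : 0 <= rnorm x.
Proof. by rewrite -ler0c -rnormE. Qed.

Lemma rnormD x y : rnorm (x + y) <= rnorm x + rnorm y.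
Proof. by rewrite -lecR rmorphD/= -!rnormE ler_normD. Qed.

Lemma rnormZ z x : rnorm (z *: x) = cnorm z * rnorm x.
Proof. by apply: complexI; rewrite rmorphM/= -!rnormE -cnormE normrZ. Qed.

Lemma rnorm0 : rnorm (0 : V) = 0.
Proof. by rewrite /rnorm normr0. Qed.

Lemma rnorm_eq0 x : rnorm x = 0 -> x = 0.
Proof. by move=> x0; apply/eqP; rewrite -normr_eq0 rnormE x0. Qed.

Lemma rnormN x : rnorm (- x) = rnorm x.
Proof. by rewrite /rnorm normrN. Qed.

Lemma rnormB x y : rnorm (x - y) <= rnorm x + rnorm y.
Proof. by rewrite -(rnormN y) rnormD. Qed.

Lemma rnorm_sum m (F : 'I_m -> V) :
  rnorm (\sum_(i < m) F i) <= \sum_(i < m) rnorm (F i).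
Proof.
elim/big_rec2: _ => [|i u v _ uv]; first by rewrite rnorm0.
by apply: le_trans (rnormD _ _) _; rewrite lerD2l.
Qed.

End RealNorm.

Section LinearFun.
Variables (K : pzRingType) (U V : lmodType K) (f : U -> V).
Hypothesis f_lin : linear f.

Definition pack_linear : {linear U -> V} :=
  HB.pack f (GRing.isLinear.Build _ _ _ _ f f_lin).

Lemma linfD u v : f (u + v) = f u + f v.
Proof. exact: (linearD pack_linear). Qed.

Lemma linfB u v : f (u - v) = f u - f v.
Proof. exact: (linearB pack_linear). Qed.

Lemma linfZ c u : f (c *: u) = c *: f u.
Proof. exact: (linearZZ pack_linear). Qed.

Lemma linf0 : f 0 = 0.
Proof. exact: (linear0 pack_linear). Qed.

Lemma linf_sum m (F : 'I_m -> U) : f (\sum_(i < m) F i) = \sum_(i < m) f (F i).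
Proof. exact: (linear_sum pack_linear). Qed.

End LinearFun.

Lemma linear_comp_fun (K : pzRingType) (U V W : lmodType K) (g : V -> W) (f : U -> V) :
  linear g -> linear f -> linear (fun x => g (f x)).
Proof. by move=> g_lin f_lin c u v; rewrite f_lin g_lin. Qed.

(** * The unitization and its actions *)

Section Unitization.
Variables (R : realType) (A : banachAlgType R[i]).

Definition unitz : Type := (R[i]^o * A)%type.
HB.instance Definition _ := GRing.Lmodule.on unitz.

Definition uone : unitz := (1, 0).
Definition emb (a : A) : unitz := (0, a).
Definition umul (u v : unitz) : unitz :=
  (u.1 * v.1, u.1 *: v.2 + v.1 *: u.2 + bmul u.2 v.2).
(** The l1 norm: it is submultiplicative, and both actions are contractive
    for it. *)
Definition unorm (u : unitz) : R := cnorm u.1 + rnorm u.2.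

Lemma bmul_linl b : linear (fun a : A => bmul a b).
Proof. exact: (bmul_bilinear.1 b). Qed.

Lemma bmul_linr a : linear (fun b : A => bmul a b).
Proof. exact: (bmul_bilinear.2 a). Qed.

Lemma bmul0l b : bmul 0 b = 0 :> A.
Proof. exact: linf0 (bmul_linl b). Qed.

Lemma bmul0r a : bmul a 0 = 0 :> A.
Proof. exact: linf0 (bmul_linr a). Qed.

Lemma rnorm_bmul (a b : A) : rnorm (bmul a b) <= rnorm a * rnorm b.
Proof. by rewrite -lecR rmorphM/= -!rnormE bmul_norm_le. Qed.

Lemma emb_lin : linear (emb : A -> unitz).
Proof. by move=> c a b; rewrite /emb; congr (_, _); rewrite /= scaler0 addr0. Qed.

Lemma umul_linl v : linear (fun u => umul u v).
Proof.
move=> c [x a] [y b]; case: v => [z d]; rewrite /umul /=; congr (_, _) => /=.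
  by rewrite mulrDl scalerAl.
rewrite bmul_linl !scalerDl !scalerDr !scalerA [z * c]mulrC.
by rewrite -[c *: x]/(c * x) [LHS](AC (2*2*2) ((1*3*5)*(2*4*6))).
Qed.

Lemma umul_linr u : linear (fun v => umul u v).
Proof.
move=> c [x a] [y b]; case: u => [z d]; rewrite /umul /=; congr (_, _) => /=.
  by rewrite mulrDr scalerAr.
rewrite bmul_linr !scalerDl !scalerDr !scalerA [z * c]mulrC .
by rewrite -[c *: x]/(c * x) [LHS](AC (2*2*2) ((1*3*5)*(2*4*6))).
Qed.

Lemma umulA : associative umul.
Proof.
move=> [x a] [y b] [z d]; rewrite /umul /=; congr (_, _) => /=.
  by rewrite mulrA.
rewrite !(linfD (bmul_linr _), linfD (bmul_linl _)).
rewrite !(linfZ (bmul_linr _), linfZ (bmul_linl _)).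
rewrite bmulA !scalerDr !scalerA [z * x]mulrC [z * y]mulrC.
by rewrite [LHS](AC (4*3) (1*(2*4*6)*(3*5*7))).
Qed.

Lemma umul1u u : umul uone u = u.
Proof. by case: u => x a; rewrite /umul /= mul1r scale1r scaler0 bmul0l !addr0. Qed.

Lemma umulu1 u : umul u uone = u.
Proof. by case: u => x a; rewrite /umul /= mulr1 scale1r scaler0 bmul0r !add0r addr0. Qed.

Lemma umul_emb a b : umul (emb a) (emb b) = emb (bmul a b).
Proof. by rewrite /umul /= mulr0 !scale0r !add0r. Qed.

Lemma unorm_ge0 u : 0 <= unorm u.
Proof. by rewrite addr_ge0 ?cnorm_ge0 ?rnorm_ge0. Qed.

Lemma unorm_umul u v : unorm (umul u v) <= unorm u * unorm v.
Proof.
rewrite /unorm /umul /= cnormM mulrDl !mulrDr.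
have := rnormD (u.1 *: v.2 + v.1 *: u.2) (bmul u.2 v.2).
have := rnormD (u.1 *: v.2) (v.1 *: u.2); rewrite !rnormZ.
have := rnorm_bmul u.2 v.2; have := mulrC (rnorm u.2) (cnorm v.1); lra.
Qed.

Lemma unorm1 : unorm uone = 1.
Proof. by rewrite /unorm /= cnorm1 rnorm0 addr0. Qed.

Lemma unorm_emb a : unorm (emb a) = rnorm a.
Proof. by rewrite /unorm /= cnorm0 add0r. Qed.

Lemma unormB u v : unorm (u - v) <= unorm u + unorm v.
Proof.
have := rnormB u.2 v.2; have := cnormD u.1 (- v.1).
rewrite /unorm /=; have -> : cnorm (- v.1) = cnorm v.1 by rewrite /cnorm normrN.
lra.
Qed.

Lemma unorm_snd u : rnorm u.2 <= unorm u.
Proof. by rewrite lerDr cnorm_ge0. Qed.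

Variable X : banachBimodType A.

Definition actl (u : unitz) (x : X) : X := u.1 *: x + lact u.2 x.
Definition actr (x : X) (u : unitz) : X := u.1 *: x + ract x u.2.

Lemma lact_linl x : linear (fun a : A => lact a x : X).
Proof. exact: (lact_bilinear.1 x). Qed.
Lemma lact_linr a : linear (fun x : X => lact a x).
Proof. exact: (lact_bilinear.2 a). Qed.
Lemma ract_linl a : linear (fun x : X => ract x a).
Proof. exact: (ract_bilinear.1 a). Qed.
Lemma ract_linr x : linear (fun a : A => ract x a : X).
Proof. exact: (ract_bilinear.2 x). Qed.

Lemma actl_linl x : linear (fun u => actl u x).
Proof.
move=> c u v; rewrite /actl /= lact_linl scalerDl scalerDr scalerA.
by rewrite -!addrA; congr (_ + _); rewrite addrCA.
Qed.

Lemma actl_linr u : linear (actl u).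
Proof.
move=> c x y; rewrite /actl lact_linr !scalerDr !scalerA [c * _]mulrC.
by rewrite -!addrA; congr (_ + _); rewrite addrCA.
Qed.

Lemma actr_linl u : linear (actr^~ u).
Proof.
move=> c x y; rewrite /actr ract_linl !scalerDr !scalerA [c * _]mulrC.
by rewrite -!addrA; congr (_ + _); rewrite addrCA.
Qed.

Lemma actr_linr x : linear (actr x).
Proof.
move=> c u v; rewrite /actr /= ract_linr scalerDl scalerDr scalerA.
by rewrite -!addrA; congr (_ + _); rewrite addrCA.
Qed.

Lemma actlM u v x : actl (umul u v) x = actl u (actl v x).
Proof.
rewrite /actl /umul /= !(linfD (lact_linl _), linfD (lact_linr _)).
rewrite !(linfZ (lact_linl _), linfZ (lact_linr _)) lactA scalerDr scalerA.
by rewrite -!addrA.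
Qed.

Lemma actrM x u v : actr x (umul u v) = actr (actr x u) v.
Proof.
rewrite /actr /umul /= !(linfD (ract_linl _), linfD (ract_linr _)).
rewrite !(linfZ (ract_linl _), linfZ (ract_linr _)) ractA scalerDr scalerA [v.1 * _]mulrC.
by rewrite -!addrA; congr (_ + _); rewrite addrCA.
Qed.

Lemma actlr u x v : actr (actl u x) v = actl u (actr x v).
Proof.
rewrite /actl /actr !(linfD (ract_linl _), linfD (lact_linr _)).
rewrite !(linfZ (ract_linl _), linfZ (lact_linr _)) lract !scalerDr !scalerA [v.1 * _]mulrC.
by rewrite -!addrA; congr (_ + _); rewrite addrCA.
Qed.

Lemma actl1 x : actl uone x = x.
Proof. by rewrite /actl /= scale1r (linf0 (lact_linl x)) addr0. Qed.

Lemma actr1 x : actr x uone = x.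
Proof. by rewrite /actr /= scale1r (linf0 (ract_linr x)) addr0. Qed.

Lemma rnorm_actl u x : rnorm (actl u x) <= unorm u * rnorm x.
Proof.
rewrite /actl /unorm mulrDl; apply: le_trans (rnormD _ _) _; rewrite rnormZ lerD2l.
by rewrite -lecR rmorphM/= -!rnormE lact_norm_le.
Qed.

Lemma rnorm_actr u x : rnorm (actr x u) <= rnorm x * unorm u.
Proof.
rewrite /actr /unorm mulrDr; apply: le_trans (rnormD _ _) _; rewrite rnormZ mulrC lerD2l.
by rewrite -lecR rmorphM/= -!rnormE ract_norm_le.
Qed.

End Unitization.

Lemma dfwithE (I : eqType) (T : Type) (a : I -> T) i x j :
  dfwith a i x j = if j == i then x else a j.
Proof.
have [->|ji] := eqVneq j i; first exact: dfwithin.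
by rewrite dfwithout// eq_sym.
Qed.

(** * Words in the unitization and their face maps *)

Section Words.
Variables (R : realType) (A : banachAlgType R[i]).
Implicit Types w : nat -> unitz A.

Definition upd (U : Type) (s : nat -> U) k x := fun j => if j == k then x else s j.

Definition glue j w := fun k =>
  if (k < j)%N then w k else if k == j then umul (w j) (w j.+1) else w k.+1.

(** The simplicial identity; for [i = j] it is the associativity of the
    product. *)
Lemma glue_glue w i j : (i <= j)%N -> glue i (glue j.+1 w) = glue j (glue i w).
Proof.
move=> ij; apply: funext => k; rewrite /glue.
have [eij|ne_ij] := eqVneq i j.
  subst i; case: (ltngtP k j) => kj; last subst k;
  do ![case: ifP => ?]; rewrite ?umulA //; exfalso; lia.
case: (ltngtP k i) => ki; last subst k; (case: (ltngtP k j) || case: (ltngtP i j)) => kj;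
  try subst k; do ![case: ifP => ?]; rewrite ?umulA //; exfalso; lia.
Qed.

(** What makes a sum over faces multilinear: changing one letter of [w] changes
    one letter of its face, linearly. *)
Lemma glue_upd w j k : exists k', exists2 f : unitz A -> unitz A, linear f &
  (forall x, glue j (upd w k x) = upd (glue j w) k' (f x)) /\
  (forall m, (j < m.+1)%N -> (k < m.+2)%N -> (k' < m.+1)%N).
Proof.
have [kj|jk|->] := ltngtP k j.
- exists k, id => //; split => [x|m]; last lia.
  apply: funext => i; rewrite /glue /upd.
  do ![case: ifP => ?]; try done; exfalso; lia.
- have [->|kj] := eqVneq k j.+1.
    exists j, (umul (w j)); [exact: umul_linr|split => [x|m]; last lia].
    apply: funext => i; rewrite /glue /upd.
    do ![case: ifP => ?]; try done; exfalso; lia.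
  exists k.-1, id => //; split => [x|m]; last lia.
  apply: funext => i; rewrite /glue /upd.
  do ![case: ifP => ?]; try done; exfalso; lia.
- exists j, (fun u => umul u (w j.+1)); [exact: umul_linl|split => [x|m]; last lia].
  apply: funext => i; rewrite /glue /upd.
  do ![case: ifP => ?]; try done; exfalso; lia.
Qed.

Lemma prod_glue w j m : (j <= m)%N ->
  \prod_(i < m.+1) unorm (glue j w i) <= \prod_(i < m.+2) unorm (w i).
Proof.
elim: m => [|m IHm].
  rewrite leqn0 => /eqP ->; rewrite big_ord1 big_ord_recr big_ord1 /=.
  by rewrite /glue /= unorm_umul.
rewrite leq_eqVlt => /orP[/eqP ->|jm]; last first.
  rewrite big_ord_recr /= [leRHS]big_ord_recr /= ler_pM ?IHm//.
  - by apply: prodr_ge0 => i _; exact: unorm_ge0.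
  - exact: unorm_ge0.
  - by rewrite /glue ltnNge ltnW//= gtn_eqF.
rewrite big_ord_recr /= [leRHS]big_ord_recr /= [X in _ <= X * _]big_ord_recr /= -mulrA.
rewrite (eq_bigr (fun i : 'I_m.+1 => unorm (w i))); last first.
  by move=> i _; rewrite /glue ltn_ord.
rewrite /glue ltnn eqxx ler_wpM2l ?unorm_umul//.
by apply: prodr_ge0 => i _; exact: unorm_ge0.
Qed.

(** The outer units make both actions of [amp] trivial. *)
Definition frame n (a : 'I_n -> A) : nat -> unitz A := fun k =>
  if k is k'.+1 then (if insub k' is Some i then emb (a i) else uone A) else uone A.

Lemma frame_last n (a : 'I_n -> A) : frame a n.+1 = uone A.
Proof. by rewrite /frame insubF// ltnn. Qed.

Lemma frame_ord n (a : 'I_n -> A) (i : 'I_n) : frame a i.+1 = emb (a i).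
Proof. by rewrite /frame valK. Qed.

End Words.

(** * Cochains as functions of words *)

Section Amplify.
Variables (R : realType) (A : banachAlgType R[i]) (X : banachBimodType A).
Implicit Types w : nat -> unitz A.

Definition multilinear n (T : ('I_n -> A) -> X) : Prop :=
  forall (i : 'I_n) (a : 'I_n -> A), linear (fun x : A => T (dfwith a i x)).

Lemma multilinear_upd n (T : ('I_n -> A) -> X) (a : nat -> A) k :
  multilinear T -> (k < n)%N -> linear (fun x => T (fun i : 'I_n => upd a k x i)).
Proof.
move=> T_lin kn c x y.
have E z : T (fun i : 'I_n => upd a k z i) = T (dfwith (fun i : 'I_n => a i) (Ordinal kn) z).
  by congr (T _); apply: funext => i; rewrite dfwithE.
by rewrite !E T_lin.
Qed.

(** Keeping the component in [A] of the inner letters amounts to extending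
    [T] to the unitization by zero on the unit. *)
Definition amp n (T : ('I_n -> A) -> X) w : X :=
  actr (actl (w 0%N) (T (fun i => (w i.+1).2))) (w n.+1).

Lemma amp_frame n (T : ('I_n -> A) -> X) (a : 'I_n -> A) : amp T (frame a) = T a.
Proof.
rewrite /amp frame_last actr1 actl1; congr (T _); apply: funext => i.
by rewrite frame_ord.
Qed.

Lemma amp_upd_linear n (T : ('I_n -> A) -> X) w k :
  multilinear T -> (k < n.+2)%N -> linear (fun x => amp T (upd w k x)).
Proof.
move=> T_lin; rewrite ltnS leq_eqVlt => /orP[/eqP ->|].
  rewrite /amp /upd /= eqxx.
  have E x : (fun i : 'I_n => (if i.+1 == n.+1 then x else w i.+1).2) = (fun i => (w i.+1).2).
    by apply: funext => i; rewrite eqSS ltn_eqF.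
  by move=> c x y; rewrite !E actr_linr.
case: k => [_|k]; first by move=> c x y; rewrite /amp /= actl_linl actr_linl.
rewrite ltnS => kn.
have E x : amp T (upd w k.+1 x) =
    actr (actl (w 0%N) (T (fun i : 'I_n => upd (fun j => (w j.+1).2) k x.2 i))) (w n.+1).
  rewrite /amp /upd /= eqSS gtn_eqF//; congr (actr (actl _ (T _)) _).
  by apply: funext => i; rewrite eqSS; case: ifP.
by move=> c x y; rewrite !E (multilinear_upd _ T_lin kn) actl_linr actr_linl.
Qed.

(** In [amp_connecting], [g j] collects what the scalar component of one
    letter contributes to the two faces that multiply it with a neighbour. *)
Lemma sum_alternate (g : nat -> X) n :
  \sum_(j < n) (-1) ^+ j.+1 *: (g j + g j.+1) = (-1) ^+ n *: g n - g 0%N.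
Proof.
elim: n => [|n IHn]; first by rewrite big_ord0 scale1r subrr.
rewrite big_ord_recr IHn /= exprS mulN1r !scaleNr scalerDr.
by rewrite addrAC opprD addrA subrr add0r.
Qed.

(** Each outer face of [connecting T] produces the term with an action and one
    with a scalar; an inner face produces [T] at the merged arguments and two
    terms in which one of the two letters acts through its scalar.  The scalar
    terms cancel by [sum_alternate]. *)
Lemma amp_connecting n (T : ('I_n -> A) -> X) w : multilinear T ->
  amp (connecting T) w = \sum_(j < n.+2) (-1) ^+ j *: amp T (glue j w).
Proof.
move=> T_lin; pose a i := (w i.+1).2.
pose omit j := T (fun i : 'I_n => if (i < j)%N then a i else a i.+1).
pose L (x : X) := actr (actl (w 0%N) x) (w n.+2).
have L_lin : linear L by move=> c x y; rewrite /L actl_linr actr_linl.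
have first_face : amp T (glue 0 w) = L (actl (w 1%N) (omit 0%N)).
  by rewrite /amp /L -actlM.
have last_face : amp T (glue n.+1 w) = L (actr (omit n) (w n.+1)).
  rewrite /amp /L -actlr /glue ltnn eqxx actrM; congr (actr (actr (actl _ (T _)) _) _).
  by apply: funext => i; rewrite ltnS ltn_ord.
have mid_face (j : 'I_n) : amp T (glue j.+1 w) =
    L ((w j.+1).1 *: omit j + (w j.+2).1 *: omit j.+1
       + T (Defs.merge j (fun i => a i))).
  rewrite /amp /L /= {3}/glue ltnS ltnNge ltnW//= eqSS gtn_eqF//.
  congr (actr (actl _ _) _).
  pose s i := if (i < j)%N then a i else a i.+1.
  have -> : (fun i : 'I_n => (glue j.+1 w i.+1).2) =
      (fun i : 'I_n => upd s j ((w j.+1).1 *: a j.+1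
         + ((w j.+2).1 *: a j + bmul (a j) (a j.+1))) i).
    apply: funext => i; rewrite /glue /upd /s /a ltnS eqSS.
    by case: ltngtP => // _; rewrite /= addrA.
  have T_lin_j := multilinear_upd s T_lin (ltn_ord j).
  rewrite (linfD T_lin_j) (linfD T_lin_j) !(linfZ T_lin_j) addrA.
  congr (_ *: T _ + _ *: T _ + T _); apply: funext => i; rewrite /upd /s /a.
  - by case: ltngtP => // ->.
  - by rewrite ltnS; case: ltngtP => // ->.
  - rewrite /Defs.merge -val_eqE /= /bump /= add1n.
    by case: (ltngtP i j) => // ->.
pose g j := (w j.+1).1 *: omit j.
rewrite big_ord_recl big_ord_recr /= first_face last_face expr0 scale1r.
rewrite (eq_bigr (fun j : 'I_n => L ((-1) ^+ j.+1 *: (g j + g j.+1)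
    + (-1) ^+ j.+1 *: T (Defs.merge j (fun i => a i))))); last first.
  by move=> j _; rewrite /bump /= add1n mid_face -(linfZ L_lin) scalerDr.
rewrite -(linf_sum L_lin) -(linfZ L_lin) -!(linfD L_lin).
rewrite big_split /= sum_alternate /amp -/(L _); congr L.
rewrite /connecting /actl /actr /bump /= add1n.
rewrite (_ : T (fun k => _) = omit 0%N); last first.
  by congr (T _); apply: funext => i; rewrite /a lift0.
rewrite (_ : T (fun k => _) = omit n); last first.
  by congr (T _); apply: funext => i; rewrite /= ltn_ord.
rewrite -/(g 0%N) scalerDr -/(g n) exprS mulN1r !scaleNr.
rewrite [RHS](AC (2*(3*2)) ((2*5*7)*(1*4)*(3*6))) /= !subrr !addr0.
by [].
Qed.

(** Going from [m] to [m + 1] adds a row and a column, with opposite signs. *)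
Lemma alternating_sum_eq0 (F : nat -> nat -> X) m :
  (forall i j, (i <= j)%N -> F i j.+1 = F j i) ->
  \sum_(j < m.+1) \sum_(i < m) (-1) ^+ (j + i) *: F i j = 0.
Proof.
move=> F_comm; elim: m => [|m IHm].
  by rewrite big1// => j _; rewrite big_ord0.
rewrite big_ord_recr /=.
under eq_bigr do rewrite big_ord_recr /=.
rewrite big_split /= IHm add0r -big_split /= big1// => i _.
rewrite (F_comm i m) -1?ltnS// addSn addnC exprS mulN1r scaleNr.
by rewrite subrr.
Qed.

Lemma connecting_connecting n (T : ('I_n -> A) -> X) a :
  multilinear T -> multilinear (connecting T) -> connecting (connecting T) a = 0.
Proof.
move=> T_lin dT_lin; rewrite -amp_frame amp_connecting//.
under eq_bigr do rewrite amp_connecting// scaler_sumr.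
under eq_bigr => j _ do under eq_bigr do rewrite scalerA -exprD.
apply: (alternating_sum_eq0 (F := fun i j => amp T (glue i (glue j (frame a))))).
by move=> i j ij; rewrite glue_glue.
Qed.

(** On framed words the faces are linear in each letter; reading the argument
    through [frame] treats the three kinds of terms of [connecting] alike. *)
Lemma multilinear_connecting n (T : ('I_n -> A) -> X) :
  multilinear T -> multilinear (connecting T).
Proof.
move=> T_lin i a c x y.
have E z : connecting T (dfwith a i z) =
    \sum_(j < n.+2) (-1) ^+ j *: amp T (glue j (upd (frame a) i.+1 (emb z))).
  rewrite -amp_frame amp_connecting//; apply: eq_bigr => j _.
  congr (_ *: amp _ (glue _ _)); apply: funext => -[|k]; rewrite /upd//=.
  case: insubP => [u ku uk|nk]; rewrite eqSS.
    by rewrite dfwithE -val_eqE /= uk; case: ifP.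
  by case: eqP nk => // ->; rewrite ltn_ord.
rewrite !E scaler_sumr -big_split /=; apply: eq_bigr => j _.
have [k' [f f_lin [glueE bnd]]] := glue_upd (frame a) j i.+1.
have k'_lt : (k' < n.+2)%N by apply: bnd; [exact: ltn_ord | exact: leqW (ltn_ord i)].
rewrite !glueE emb_lin f_lin amp_upd_linear//.
by rewrite scalerDr !scalerA mulrC.
Qed.

Lemma rnorm_amp n (T : ('I_n -> A) -> X) c w :
  (forall a, rnorm (T a) <= c * \prod_i rnorm (a i)) -> 0 <= c ->
  rnorm (amp T w) <= c * \prod_(i < n.+2) unorm (w i).
Proof.
move=> T_bnd c0; rewrite big_ord_recr big_ord_recl /= mulrA.
apply: le_trans (rnorm_actr _ _) _; rewrite ler_wpM2r ?unorm_ge0//.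
apply: le_trans (rnorm_actl _ _) _; rewrite mulrCA ler_wpM2l ?unorm_ge0//.
apply: le_trans (T_bnd _) _; rewrite ler_wpM2l//.
apply: ler_prod => i _; rewrite rnorm_ge0 /=.
exact: unorm_snd.
Qed.

Lemma prod_frame n (a : 'I_n -> A) :
  \prod_(i < n.+2) unorm (frame a i) = \prod_(i < n) rnorm (a i).
Proof.
rewrite big_ord_recr big_ord_recl frame_last /= unorm1 mulr1 mul1r.
by apply: eq_bigr => i _; rewrite -unorm_emb -frame_ord.
Qed.

Lemma rnorm_connecting n (T : ('I_n -> A) -> X) c a : multilinear T ->
  (forall a, rnorm (T a) <= c * \prod_i rnorm (a i)) -> 0 <= c ->
  rnorm (connecting T a) <= n.+2%:R * c * \prod_i rnorm (a i).
Proof.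
move=> T_lin T_bnd c0; rewrite -amp_frame amp_connecting//.
apply: le_trans (rnorm_sum _) _; rewrite -mulrA mulr_natl -{7}(card_ord n.+2) -sumr_const.
apply: ler_sum => j _; rewrite rnormZ cnorm_sign mul1r -prod_frame.
apply: le_trans (rnorm_amp _ T_bnd c0) _.
by rewrite ler_wpM2l// prod_glue// -ltnS.
Qed.

End Amplify.

(** * Strong property (B) and the pairs (b, 1) *)

Section BilinearGap.
Variables (R : realType) (A : banachAlgType R[i]) (M r : R).
Hypotheses (units_A : bounded_local_units A M) (B_A : strong_property_B A r).
Variable X : completeNormedModType R[i].

Definition gap_constant : R := M ^+ 2 * r + (M + 1) ^+ 2.

Lemma local_unit_bound_ge0 : 0 <= M.
Proof.
have [A0 [denseA0 unitsA0]] := units_A.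
have [|a [_ A0a]] := denseA0 setT _ openT; first by exists 0.
have [e [eM _ _]] := unitsA0 _ A0a.
exact: le_trans (rnorm_ge0 _) eM.
Qed.

Lemma gap_constant_ge0 : 0 <= gap_constant.
Proof.
have M0 := local_unit_bound_ge0; have [r0 _] := B_A.
by rewrite /gap_constant addr_ge0 ?sqr_ge0// mulr_ge0 ?sqr_ge0// ltW.
Qed.

Variables (phi : unitz A -> unitz A -> X) (c D : R).
Hypotheses (phi_linl : forall v, linear (phi^~ v)).
Hypotheses (phi_linr : forall u, linear (phi u)).
Hypotheses (c_ge0 : 0 <= c) (D_ge0 : 0 <= D).
Hypothesis phi_bounded : forall u v, rnorm (phi u v) <= c * (unorm u * unorm v).
Hypothesis phi_gap : forall u v, umul u v = 0 -> rnorm (phi u v) <= D * (unorm u * unorm v).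
Hypothesis phi_one : forall v, phi (uone A) v = 0.

(** With [e' = 1 - e], the value at [(b, 1)] is
    [(phi(eb, e) - phi(e, be)) + phi(b, e') - phi(e', b)], because
    [phi(1, b) = 0].  The strong property (B) bounds the first term by
    [M ^ 2 r D ||b||], and the other two by [(M + 1) D ||b||] each;
    [2 (M + 1) <= (M + 1) ^ 2] as soon as [A] is not zero. *)
Lemma phi_emb_one_units b e : rnorm e <= M -> bmul b e = b -> bmul e b = b ->
  rnorm (phi (emb b) (uone A)) <= gap_constant * D * rnorm b.
Proof.
move=> eM be eb.
have [b0|b_neq0] := eqVneq (rnorm b) 0.
  rewrite b0 mulr0 (rnorm_eq0 b0) (linf0 (@emb_lin _ A)) (linf0 (phi_linl _)).
  by rewrite rnorm0.
have b_gt0 : 0 < rnorm b by rewrite lt_def b_neq0 rnorm_ge0.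
(* A nonzero vector with a local unit forces [M >= 1]. *)
have M_ge1 : 1 <= M.
  rewrite -(ler_pM2r b_gt0) mul1r -{1}eb; apply: le_trans (rnorm_bmul _ _) _.
  by rewrite ler_wpM2r ?rnorm_ge0.
pose e' := uone A - emb e.
have e'_le : unorm e' <= 1 + M.
  apply: le_trans (unormB _ _) _; rewrite unorm1 unorm_emb lerD2l//.
have be' : umul (emb b) e' = 0.
  by rewrite (linfB (umul_linr _)) umulu1 umul_emb be subrr.
have e'b : umul e' (emb b) = 0.
  by rewrite (linfB (umul_linl _)) umul1u umul_emb eb subrr.
pose psi a a' := phi (emb a) (emb a').
have psi_bb : bounded_bilinear psi.
  split; last by exists c => a a'; rewrite -!unorm_emb; exact: phi_bounded.
  split=> [a' x y z|a x y z]; rewrite /psi emb_lin; [exact: phi_linl|exact: phi_linr].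
have alpha_le : alphaB psi <= D.
  apply: ge_sup.
    by exists (rnorm (psi 0 0)), 0, 0; rewrite rnorm0 bmul0l; split => //; exact: ler01.
  move=> _ [a [a' [a1 a'1 aa' ->]]].
  apply: le_trans (phi_gap _) _; first by rewrite umul_emb aa' (linf0 (@emb_lin _ A)).
  rewrite !unorm_emb ler_piMr// -[leRHS]mulr1 ler_pM ?rnorm_ge0//.
have [r_gt0 /(_ _ _ psi_bb e b e)] := B_A; rewrite eb be => psiB.
have -> : phi (emb b) (uone A) =
    (psi b e - psi e b) + phi (emb b) e' - phi e' (emb b).
  rewrite /e' (linfB (phi_linr _)) (linfB (phi_linl _)) phi_one /psi sub0r opprK.
  by rewrite addrAC subrK addrC subrK.
apply: le_trans (rnormB _ _) _; apply: le_trans (lerD (rnormD _ _) (lexx _)) _.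
have h1 := phi_gap be'; have h2 := phi_gap e'b.
rewrite !unorm_emb in h1 h2.
have h3 : r * alphaB psi * rnorm e * rnorm b * rnorm e <= M ^+ 2 * r * (D * rnorm b).
  have e0 := rnorm_ge0 e.
  rewrite [leLHS](_ : _ = (rnorm e * rnorm e) * (r * (alphaB psi * rnorm b))); last by ring.
  rewrite -[leRHS]mulrA; apply: (@le_trans _ _ (rnorm e * rnorm e * (r * (D * rnorm b)))).
    by rewrite ler_wpM2l ?mulr_ge0// ler_wpM2l ?(ltW r_gt0)// ler_wpM2r ?(ltW b_gt0).
  by rewrite ler_wpM2r ?mulr_ge0 ?(ltW r_gt0) ?(ltW b_gt0)// expr2 ler_pM.
have h4 : D * (rnorm b * unorm e') <= (1 + M) * (D * rnorm b).
  by rewrite mulrA [leRHS]mulrC ler_wpM2l// mulr_ge0 ?(ltW b_gt0).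
have h5 : (1 + M) * 2 * (D * rnorm b) <= (M + 1) ^+ 2 * (D * rnorm b).
  by rewrite ler_wpM2r ?mulr_ge0 ?(ltW b_gt0)//; nra.
rewrite /gap_constant; rewrite [unorm e' * _]mulrC in h2.
move: psiB h1 h2 h3 h4 h5; lra.
Qed.

Lemma phi_emb_one b : rnorm (phi (emb b) (uone A)) <= gap_constant * D * rnorm b.
Proof.
have [A0 [denseA0 unitsA0]] := units_A.
apply/ler_addgt0Pr => eps eps0.
have KD_ge0 : 0 <= gap_constant * D by rewrite mulr_ge0 ?gap_constant_ge0.
(* Moving [b] by [d] changes both sides by at most [eps] in total. *)
pose d := eps / (gap_constant * D + c + 1).
have den_gt0 : 0 < gap_constant * D + c + 1 by rewrite ltr_wpDl ?addr_ge0.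
have d_gt0 : 0 < d by rewrite divr_gt0.
have [b' [bb' A0b']] : (ball b d%:C `&` A0) !=set0.
  apply: denseA0; last exact: ball_open.
  by exists b; apply: ballxx; rewrite ltcR.
have {}bb' : rnorm (b - b') < d.
  by move: bb'; rewrite -ball_normE /ball_ /= rnormE ltcR.
have [e [eM b'e eb']] := unitsA0 _ A0b'.
have h1 := phi_emb_one_units eM b'e eb'.
have h2 := phi_bounded (emb (b - b')) (uone A); rewrite unorm1 mulr1 unorm_emb in h2.
have h3 : rnorm b' <= rnorm b + d.
  rewrite -[b'](subrK b) addrC; apply: le_trans (rnormD _ _) _.
  by rewrite lerD2l -rnormN opprB ltW.
have -> : phi (emb b) (uone A) = phi (emb (b - b')) (uone A) + phi (emb b') (uone A).
  by rewrite -(linfD (phi_linl _)) -(linfD (@emb_lin _ A)) subrK.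
apply: le_trans (rnormD _ _) _.
apply: le_trans (lerD h2 h1) _.
have h4 : (gap_constant * D + c + 1) * d = eps by rewrite mulrC divfK// gt_eqF.
have h5 : c * rnorm (b - b') <= c * d by rewrite ler_wpM2l// ltW.
have h6 : gap_constant * D * rnorm b' <= gap_constant * D * (rnorm b + d).
  by rewrite ler_wpM2l.
rewrite -h4; move: h5 h6 d_gt0; lra.
Qed.

End BilinearGap.

(** * Estimate of the connecting map *)

Section Chain.
Variables (R : realType) (A : banachAlgType R[i]) (M r : R).
Hypotheses (units_A : bounded_local_units A M) (B_A : strong_property_B A r).
Variable X : banachBimodType A.

(** Neighbouring letters have the product [q_i (p_i q_(i+1)) p_(i+1)], so that
    it depends on the gap [(p_i, q_(i+1))], and the word is linear in each of the
    [p_i] and [q_i] separately. *)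
Definition word (p q : nat -> unitz A) : nat -> unitz A :=
  fun k => if k is i.+1 then umul (q i) (p i) else uone A.

Lemma word_updl p q k u :
  word (upd p k u) q = upd (word p q) k.+1 (umul (q k) u).
Proof. by apply: funext => -[|i] //; rewrite /word /upd eqSS; case: eqP => // ->. Qed.

Lemma word_updr p q k v :
  word p (upd q k v) = upd (word p q) k.+1 (umul v (p k)).
Proof. by apply: funext => -[|i] //; rewrite /word /upd eqSS; case: eqP => // ->. Qed.

Lemma prod_word p q n : q 0%N = uone A -> p n.+1 = uone A ->
  \prod_(i < n.+3) unorm (word p q i) <=
  \prod_(i < n.+1) (unorm (p i) * unorm (q i.+1)).
Proof.
move=> q0 pn; rewrite big_ord_recl /= unorm1 mul1r.
apply: (@le_trans _ _ (\prod_(i < n.+2) (unorm (q i) * unorm (p i)))).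
  by apply: ler_prod => i _; rewrite unorm_ge0 unorm_umul.
rewrite !big_split /= [X in _ * X <= _]big_ord_recr /= pn unorm1 mulr1.
by rewrite big_ord_recl /= q0 unorm1 mul1r mulrC.
Qed.

Lemma amp_slot0 n (T : ('I_n -> A) -> X) w k :
  multilinear T -> (k < n.+2)%N -> w k = 0 -> amp T w = 0.
Proof.
move=> T_lin kn wk0; have := linf0 (amp_upd_linear w T_lin kn).
rewrite (_ : upd w k 0 = w)//; apply: funext => i; rewrite /upd.
by case: eqP => // ->.
Qed.

Lemma amp_middle0 n (T : ('I_n -> A) -> X) w k :
  multilinear T -> (k < n)%N -> (w k.+1).2 = 0 -> amp T w = 0.
Proof.
move=> T_lin kn wk0; have := linf0 (multilinear_upd (fun i => (w i.+1).2) T_lin kn).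
rewrite /amp (_ : (fun i : 'I_n => upd _ k 0 i) = (fun i : 'I_n => (w i.+1).2)).
  by move=> ->; rewrite (linf0 (actl_linr _)) (linf0 (actr_linl _)).
by apply: funext => i; rewrite /upd; case: eqP => // ->.
Qed.

(** All faces but the first have a zero letter. *)
Lemma amp_connecting_gaps n (T : ('I_n -> A) -> X) p q : multilinear T ->
  (forall i, (i <= n)%N -> umul (p i) (q i.+1) = 0) ->
  amp (connecting T) (word p q) = amp T (glue 0 (word p q)).
Proof.
move=> T_lin gaps; rewrite amp_connecting// big_ord_recl scale1r big1 ?addr0// => j _.
rewrite (amp_slot0 (k := j.+1)) ?scaler0//; first by rewrite ltnS ltn_ord.
rewrite lift0 /glue ltnn eqxx /= -umulA (umulA (p j)) gaps ?(linf0 (umul_linl _))//.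
  by rewrite (linf0 (umul_linr _)).
by rewrite -ltnS.
Qed.

Variables (n : nat) (T : ('I_n -> A) -> X) (D : R).
Hypotheses (T_bm : bounded_maps X n T) (D_ge0 : 0 <= D).
Hypothesis T_near : forall a eps, 0 < eps ->
  exists2 S, cocycles X n S & rnorm (T a - S a) <= D * \prod_i rnorm (a i) + eps.

(** For a cocycle [S] the surviving face vanishes, so that it can be evaluated
    at [T - S], with [S] chosen for the arguments at hand. *)
Lemma rnorm_amp_gaps p q : q 0%N = uone A -> p n.+1 = uone A ->
  (forall i, (i <= n)%N -> umul (p i) (q i.+1) = 0) ->
  rnorm (amp (connecting T) (word p q)) <=
    D * \prod_(i < n.+1) (unorm (p i) * unorm (q i.+1)).
Proof.
move=> q0 pn gaps; set w := word p q; have [T_lin _] := T_bm.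
rewrite amp_connecting_gaps//.
pose a (i : 'I_n) := (w i.+2).2.
apply/ler_addgt0Pr => eps eps0.
pose N := unorm (w 1%N) * unorm (w n.+2).
have N_ge0 : 0 <= N by rewrite mulr_ge0 ?unorm_ge0.
have d_gt0 : 0 < eps / (N + 1) by rewrite divr_gt0// ltr_wpDl.
have [S [[S_lin _] dS0] TS] := T_near a d_gt0.
have S0 : amp S (glue 0 w) = 0.
  rewrite -amp_connecting_gaps// /amp dS0.
  by rewrite (linf0 (actl_linr _)) (linf0 (actr_linl _)).
rewrite -[amp T _]subr0 -S0 /amp -(linfB (actr_linl _)) -(linfB (actl_linr _)) /=.
rewrite -/(a _).
apply: le_trans (rnorm_actr _ _) _.
apply: le_trans (ler_wpM2r (unorm_ge0 _) (rnorm_actl _ _)) _.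
rewrite mulrAC -[glue 0 w n.+1]/(w n.+2) {1}/glue /= [umul _ _]umul1u -/(w 1%N) -/N.
apply: le_trans (ler_wpM2l N_ge0 TS) _.
rewrite mulrDr; apply: lerD; last first.
  by rewrite mulrCA ler_piMr ?(ltW eps0)// ler_pdivrMr ?mul1r ?lerDl// ltr_wpDl.
rewrite mulrCA ler_wpM2l//; apply: le_trans (prod_word q0 pn).
have -> : \prod_(i < n.+3) unorm (word p q i) = N * \prod_(i < n) unorm (w i.+2).
  by rewrite big_ord_recl /= unorm1 mul1r big_ord_recr big_ord_recl /= mulrAC.
rewrite ler_wpM2l// ler_prod// => i _; rewrite rnorm_ge0 /=.
exact: unorm_snd.
Qed.

(** The gaps are treated from left to right: the first [m] are of the form
    [(b, 1)], the others have zero product.  In gap [m] the value at [(1, v)]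
    vanishes because its left neighbour [q_m] is already [1], which leaves the
    unit as a letter seen by [connecting T]. *)
Lemma rnorm_amp_chain m p q : (m <= n.+1)%N ->
  q 0%N = uone A -> p n.+1 = uone A ->
  (forall i, (i < m)%N -> (p i).1 = 0 /\ q i.+1 = uone A) ->
  (forall i, (m <= i <= n)%N -> umul (p i) (q i.+1) = 0) ->
  rnorm (amp (connecting T) (word p q)) <=
    gap_constant M r ^+ m * D * \prod_(i < n.+1) (unorm (p i) * unorm (q i.+1)).
Proof.
have [T_lin [c0 T_bnd]] := T_bm.
have [c c_ge0 dT_bnd] : exists2 c, 0 <= c &
    forall a, rnorm (connecting T a) <= c * \prod_i rnorm (a i).
  exists (n.+2%:R * `|c0|); first by rewrite mulr_ge0.
  move=> a; apply: rnorm_connecting => // a'; apply: le_trans (T_bnd _) _.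
  by rewrite ler_wpM2r ?ler_norm// prodr_ge0// => i _; exact: rnorm_ge0.
have dT_lin := multilinear_connecting T_lin.
elim: m p q => [|m IHm] p q mn q0 pn done_gaps gaps.
  by rewrite expr0 mul1r rnorm_amp_gaps.
have K0 := gap_constant_ge0 units_A B_A.
have [pm qm] := done_gaps m (ltnSn m).
pose phi u v := amp (connecting T) (word (upd p m u) (upd q m.+1 v)).
pose rest := \prod_(i < n.+1 | i != Ordinal mn) (unorm (p i) * unorm (q i.+1)).
have rest_ge0 : 0 <= rest by apply: prodr_ge0 => i _; rewrite mulr_ge0 ?unorm_ge0.
have upd_prod u v : \prod_(i < n.+1) (unorm (upd p m u i) * unorm (upd q m.+1 v i.+1)) =
    unorm u * unorm v * rest.
  rewrite (bigD1 (Ordinal mn)) //= /upd !eqxx; congr (_ * _).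
  apply: eq_bigr => i; rewrite -val_eqE /= => /negPf im.
  by rewrite eqSS im.
have upd_q0 v : upd q m.+1 v 0%N = uone A by [].
have upd_pn u : upd p m u n.+1 = uone A by rewrite /upd gtn_eqF.
have -> : amp (connecting T) (word p q) = phi (emb (p m).2) (uone A).
  congr (amp _ (word _ _)); apply: funext => i; rewrite /upd; case: eqP => // ->//.
  by rewrite /emb -pm; case: (p m).
have qm1 : q m = uone A.
  by case: (m) done_gaps => [|m' /(_ m')] //; case; rewrite ?ltnS// ltnW.
rewrite (bigD1 (Ordinal mn)) //= qm unorm1 mulr1 -/rest.
rewrite [X in unorm X * _](_ : _ = emb (p m).2); last by rewrite /emb -pm; case: (p m).
rewrite unorm_emb exprS.
rewrite [leRHS](_ : _ =
  gap_constant M r * (gap_constant M r ^+ m * D * rest) * rnorm (p m).2); last by ring.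
apply: (phi_emb_one units_A B_A (c := c * rest)).
- move=> v; rewrite /phi.
  under [X in linear X]eq_fun do rewrite word_updl.
  apply: (linear_comp_fun (g := fun x => amp _ (upd _ _ x))).
    by apply: amp_upd_linear => //; rewrite ltnS ltnW.
  exact: umul_linr.
- move=> u; rewrite /phi.
  under [X in linear X]eq_fun do rewrite word_updr.
  apply: (linear_comp_fun (g := fun x => amp _ (upd _ _ x))).
    by apply: amp_upd_linear.
  exact: umul_linl.
- by rewrite mulr_ge0.
- by rewrite !mulr_ge0 ?exprn_ge0.
- move=> u v; apply: le_trans (rnorm_amp _ dT_bnd c_ge0) _.
  rewrite -mulrA ler_wpM2l//; apply: le_trans (prod_word (upd_q0 v) (upd_pn u)) _.
  by rewrite upd_prod mulrC.
- move=> u v uv; apply: le_trans (IHm _ _ (ltnW mn) (upd_q0 v) (upd_pn u) _ _) _.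
  + move=> i im; rewrite /upd eqSS !ltn_eqF//.
    exact: done_gaps (leqW im).
  + move=> i /andP[mi ni]; rewrite /upd eqSS; case: eqP => // /eqP im.
    by apply: gaps; rewrite ni ltn_neqAle eq_sym im mi.
  + by rewrite upd_prod [_ * rest]mulrC !mulrA.
- move=> v; apply: (amp_middle0 (k := m)) => //.
  by rewrite /word /upd eqxx ltn_eqF// qm1 umul1u.
Qed.

Lemma rnorm_connecting_le a :
  rnorm (connecting T a) <= gap_constant M r ^+ n.+1 * D * \prod_i rnorm (a i).
Proof.
pose p i := frame a i.+1.
have -> : connecting T a = amp (connecting T) (word p (fun=> uone A)).
  rewrite -amp_frame; congr (amp _ _); apply: funext => -[|i] //=.
  by rewrite umul1u.
apply: le_trans (rnorm_amp_chain (leqnn _) _ _ _ _) _ => //.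
- exact: frame_last.
- by move=> i ni; split=> //; rewrite /p (frame_ord a (Ordinal ni)).
- by move=> i; lia.
- rewrite (eq_bigr (fun i => rnorm (a i)))// => i _.
  by rewrite unorm1 mulr1 /p frame_ord unorm_emb.
Qed.

End Chain.

(** * An open mapping theorem for two seminorms *)

Section OpenMapping.
Variables (R : realType) (V : lmodType R[i]) (B : set V).

Definition real_subspace : Prop :=
  B 0 /\ forall (t : R) u v, B u -> B v -> B (t%:C *: u + v).

Definition seminorm_on (p : V -> R) : Prop :=
  [/\ forall v, B v -> 0 <= p v,
      forall u v, B u -> B v -> p (u + v) <= p u + p v &
      forall (t : R) v, B v -> p (t%:C *: v) = `|t| * p v].

(** Completeness, tested on sequences whose increments have bounds that halve
    at each step; summing these bounds gives the one on the distance to the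
    limit. *)
Definition fast_complete (p : V -> R) : Prop :=
  forall (v : nat -> V) (t : nat -> R),
    (forall j, B (v j)) -> (forall j, t j.+1 <= t j / 2) ->
    (forall j, p (v j.+1 - v j) <= t j) ->
    exists2 u, B u & forall j, p (u - v j) <= 2 * t j.

Hypothesis subspace_B : real_subspace.

Lemma real_subspaceD u v : B u -> B v -> B (u + v).
Proof. by move=> Bu Bv; rewrite -[u]scale1r; exact: subspace_B.2. Qed.

Lemma real_subspaceZ (t : R) u : B u -> B (t%:C *: u).
Proof.
by move=> Bu; rewrite -[_ *: _]addr0; apply: subspace_B.2 => //; exact: subspace_B.1.
Qed.

Lemma real_scaleN1 (u : V) : (-1)%:C *: u = - u.
Proof. by rewrite rmorphN1 scaleN1r. Qed.

Lemma real_subspaceB u v : B u -> B v -> B (u - v).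
Proof.
move=> Bu Bv; apply: real_subspaceD => //.
by rewrite -real_scaleN1; exact: real_subspaceZ.
Qed.

Lemma seminorm_onN p v : seminorm_on p -> B v -> p (- v) = p v.
Proof. by move=> [_ _ pZ] Bv; rewrite -real_scaleN1 pZ// normrN1 mul1r. Qed.

Lemma seminorm_on0 p : seminorm_on p -> p 0 = 0.
Proof.
move=> [_ _ pZ]; have := pZ 0 0 subspace_B.1; by rewrite scaler0 normr0 mul0r.
Qed.

Lemma seminorm_onB p u v : seminorm_on p -> B u -> B v -> p (u - v) <= p u + p v.
Proof.
move=> pS Bu Bv; rewrite -(seminorm_onN pS Bv); have [_ pD _] := pS.
by apply: pD => //; rewrite -[- v]sub0r; apply: real_subspaceB => //; exact: subspace_B.1.
Qed.

Lemma geometric_bound_le0 (x c : R) : 0 <= c -> (forall j : nat, x <= c / 2 ^+ j) -> x <= 0.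
Proof.
move=> c0 xc; rewrite leNgt; apply/negP => x0.
have [j cxj] : exists j : nat, c / x < j%:R.
  by exists (Num.bound (c / x)); apply: archi_boundP; rewrite divr_ge0// ltW.
have := xc j; rewrite leNgt => /negP; apply.
rewrite ltr_pdivrMr ?exprn_gt0// mulrC -ltr_pdivrMr//; apply: lt_le_trans cxj _.
by rewrite -natrX ler_nat ltnW// ltn_expl.
Qed.

Variables p s : V -> R.
Hypotheses (p_norm : seminorm_on p) (s_norm : seminorm_on s).
Hypotheses (p_complete : fast_complete p) (s_complete : fast_complete s).

Let p_ge0 v : B v -> 0 <= p v. Proof. by have [+ _ _] := p_norm; exact. Qed.
Let s_ge0 v : B v -> 0 <= s v. Proof. by have [+ _ _] := s_norm; exact. Qed.

(** The Baire category argument, as a gliding hump.  If no [k] works, small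
    corrections lead to a fast sequence [v j] whose distance to
    [{u | p u <= j}] exceeds a radius [t j] that dominates all later
    corrections; its limit [u] then contradicts [p u < +oo]. *)
Lemma ball_in_closure : exists2 k, 0 < k &
  forall v eps, B v -> s v <= 1 -> 0 < eps -> exists u, [/\ B u, p u <= k & s (v - u) <= eps].
Proof.
apply: contrapT => no_k.
have far (k eta : R) : exists ze : V * R, 0 < k -> 0 < eta ->
    [/\ B ze.1, 0 < ze.2, s ze.1 <= eta & forall u, B u -> p u <= k -> ze.2 < s (ze.1 - u)].
  have [k0|k0] := ltP 0 k; last by exists (0, 0).
  have [eta0|eta0] := ltP 0 eta; last by exists (0, 0).
  apply: contrapT => near; apply: no_k; exists (k / eta); first exact: divr_gt0.
  move=> v eps Bv sv eps0; apply: contrapT => no_u; apply: near.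
  exists (eta%:C *: v, eta * eps) => _ _ /=.
  have [_ _ sZ] := s_norm; have [_ _ pZ] := p_norm; split.
  - exact: real_subspaceZ.
  - exact: mulr_gt0.
  - by rewrite sZ// gtr0_norm// ler_piMr// ltW.
  - move=> u Bu pu.
    have Bu' := real_subspaceZ (eta^-1) Bu.
    have -> : eta%:C *: v - u = eta%:C *: (v - (eta^-1)%:C *: u).
      by rewrite scalerBr scalerA -rmorphM/= divff ?gt_eqF// scale1r.
    rewrite sZ ?gtr0_norm ?ltr_pM2l//; last exact: real_subspaceB.
    rewrite ltNge; apply/negP => svu; apply: no_u.
    exists ((eta^-1)%:C *: u); split=> //.
    by rewrite pZ// gtr0_norm ?invr_gt0// mulrC ler_wpM2r// invr_ge0 ltW.
have step (xj : (V * R) * nat) : exists y : V * R, B xj.1.1 -> 0 < xj.1.2 ->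
    [/\ B y.1, 0 < y.2, y.2 <= xj.1.2 / 2, s (y.1 - xj.1.1) <= xj.1.2 / 4 &
        forall u, B u -> p u <= xj.2%:R -> y.2 < s (y.1 - u)].
  case: xj => -[v eta] j /=.
  (* [p u <= j] implies [p (u - v) <= j + p v], hence the choice of this level. *)
  have [[z eps] far_z] := far (j%:R + p v + 1) (eta / 4).
  (* Later corrections add up to at most half of the new radius. *)
  exists (v + z, Num.min eps (eta / 2)) => /= Bv eta0.
  have [||/= Bz eps0 sz z_far] := far_z; [|by rewrite divr_gt0|].
    by rewrite ltr_wpDl// addr_ge0// p_ge0.
  split.
  - exact: real_subspaceD.
  - by rewrite lt_min eps0 divr_gt0.
  - by rewrite ge_min lexx orbT.
  - by rewrite addrC addKr.
  - move=> u Bu pu; rewrite gt_min; apply/orP; left.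
    rewrite (_ : v + z - u = z - (u - v)); last by rewrite opprB addrA [z + v]addrC.
    apply: z_far; first exact: real_subspaceB.
    apply: le_trans (seminorm_onB p_norm Bu Bv) _.
    by move: pu; lra.
have [f fP] := choice step.
pose x := fix x j : V * R := if j is j'.+1 then f (x j', j') else (0, 1).
have x_ok j : B (x j).1 /\ 0 < (x j).2.
  elim: j => [|j [Bj pos]] /=; first by split; [exact: subspace_B.1|].
  by have [] := fP (x j, j) Bj pos.
have [|||u Bu su] := s_complete (v := fun j => (x j).1) (t := fun j => (x j).2 / 4).
- by move=> j; have [] := x_ok j.
- move=> j; have [Bj pos] := x_ok j.
  by have [_ _ + _ _] := fP (x j, j) Bj pos; rewrite /=; lra.
- by move=> j; have [Bj pos] := x_ok j; have [] := fP (x j, j) Bj pos.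
have [j puj] : exists j : nat, p u <= j%:R.
  by exists (Num.bound (p u)); apply/ltW/archi_boundP/p_ge0.
have [Bj pos] := x_ok j; have [BSj posS _ _ /(_ u Bu puj)] := fP (x j, j) Bj pos.
have := su j.+1; rewrite -(seminorm_onN s_norm) ?opprB /=; last exact: real_subspaceB.
move: posS => /=; lra.
Qed.

Variable L : R.
Hypothesis s_le : forall v, B v -> s v <= L * p v.

(** Here [s] stands for the norm of the image under an operator whose kernel
    is [s = 0]: completeness of [s] is completeness of the image, and [u] is a
    preimage of controlled norm, reached by successive approximation. *)
Theorem open_mapping : exists2 C, 0 <= C &
  forall v, B v -> exists u, [/\ B u, s (v - u) = 0 & p u <= C * s v].
Proof.
have [k k0 k_ball] := ball_in_closure.
have [_ _ sZ] := s_norm; have [_ _ pZ] := p_norm.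
exists (2 * k) => [|v Bv]; first by rewrite mulr_ge0// ltW.
have [sv0|sv_neq0] := eqVneq (s v) 0.
  exists 0; split; first exact: subspace_B.1.
  - by rewrite subr0.
  - by rewrite (seminorm_on0 p_norm) sv0 mulr0.
have sv_gt0 : 0 < s v by rewrite lt_def sv_neq0 s_ge0.
have halve (xt : V * R) : exists u, B xt.1 -> 0 < xt.2 -> s xt.1 <= xt.2 ->
    [/\ B u, p u <= k * xt.2 & s (xt.1 - u) <= xt.2 / 2].
  case: xt => x t /=; have [t0|t0] := ltP 0 t; last by exists 0.
  have [Bx|nBx] := pselect (B x); last by exists 0.
  have [sx|sx] := leP (s x) t; last by exists 0.
  have [||| u [Bu pu su]] := k_ball ((t^-1)%:C *: x) (2^-1).
  - exact: real_subspaceZ.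
  - by rewrite sZ// gtr0_norm ?invr_gt0// mulrC ler_pdivrMr// mul1r.
  - by rewrite invr_gt0.
  exists (t%:C *: u) => _ _ _; split; first exact: real_subspaceZ.
  - by rewrite pZ// gtr0_norm// mulrC ler_wpM2r// ltW.
  - rewrite (_ : x - _ = t%:C *: ((t^-1)%:C *: x - u)); last first.
      by rewrite scalerBr scalerA -rmorphM/= divff ?gt_eqF// scale1r.
    rewrite sZ; last by apply: real_subspaceB => //; exact: real_subspaceZ.
    by rewrite gtr0_norm// ler_wpM2l// ltW.
have [g gP] := choice halve.
pose t j : R := s v / 2 ^+ j.
have t_gt0 j : 0 < t j by rewrite divr_gt0// exprn_gt0.
have tS j : t j.+1 = t j / 2 by rewrite /t exprSr invfM mulrA.
(* [rem j] is what remains to be lifted after [j] steps. *)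
pose rem := fix rem j := if j is j'.+1 then rem j' - g (rem j', t j') else v.
have rem_ok j : B (rem j) /\ s (rem j) <= t j.
  elim: j => [|j [Bj sj]]; first by rewrite /t expr0 divr1.
  have [Bg _ sg] := gP (rem j, t j) Bj (t_gt0 j) sj.
  by rewrite tS; split=> //; exact: real_subspaceB.
have [||| u Bu pu] := p_complete (v := fun j => v - rem j) (t := fun j => k * t j).
- by move=> j; apply: real_subspaceB => //; have [] := rem_ok j.
- by move=> j; rewrite tS mulrA.
- move=> j; have [Bj sj] := rem_ok j; have [_ + _] := gP (rem j, t j) Bj (t_gt0 j) sj.
  rewrite /= (_ : v - (rem j - g (rem j, t j)) - (v - rem j) = g (rem j, t j))//.
  by rewrite !opprB [LHS](AC ((1*2)*2) (2*(1*5)*(4*3))) /= !subrr !addr0.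
exists u; split=> //; last first.
  by have := pu 0%N; rewrite /= subrr subr0 /t expr0 divr1 mulrA.
apply/eqP; rewrite eq_le s_ge0 ?andbT; last exact: real_subspaceB.
have L'_ge0 : 0 <= 1 + `|L| * (2 * k).
  by rewrite addr_ge0// mulr_ge0// mulr_ge0// ltW.
apply: (@geometric_bound_le0 _ ((1 + `|L| * (2 * k)) * s v)).
  by rewrite mulr_ge0// ltW.
move=> j; rewrite -mulrA -/(t j); have [Bj sj] := rem_ok j.
have Bw : B (u - (v - rem j)) by do 2![apply: real_subspaceB => //].
rewrite (_ : v - u = rem j - (u - (v - rem j))); last first.
  by rewrite !opprB [RHS](AC (1*((1*1)*1)) ((2*4)*(1*3))) /= subrr addr0.
apply: le_trans (seminorm_onB s_norm Bj Bw) _.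
rewrite mulrDl mul1r lerD// -mulrA -mulrA; apply: le_trans (s_le Bw) _.
apply: (@le_trans _ _ (`|L| * p (u - (v - rem j)))).
  by rewrite ler_wpM2r ?p_ge0// ler_norm.
by rewrite ler_wpM2l.
Qed.

End OpenMapping.

(** * Norms of cochains *)

Section Limits.
Variables (R : realType) (V : completeNormedModType R[i]).

Lemma fast_telescope (x : nat -> V) (t : nat -> R) j k :
  (forall j, t j.+1 <= t j / 2) -> (forall j, rnorm (x j.+1 - x j) <= t j) ->
  rnorm (x (j + k)%N - x j) <= 2 * t j - 2 * t (j + k)%N.
Proof.
move=> tS xS; elim: k => [|k IHk]; first by rewrite addn0 !subrr rnorm0.
rewrite addnS -(subrKA (x (j + k)%N)); apply: le_trans (rnormD _ _) _.
have := xS (j + k)%N; have := tS (j + k)%N; move: IHk; lra.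
Qed.

Lemma fast_le (t : nat -> R) j : (forall j, t j.+1 <= t j / 2) -> t j <= t 0%N / 2 ^+ j.
Proof.
move=> tS; elim: j => [|j IHj]; first by rewrite expr0 divr1.
rewrite exprSr invfM mulrA; have := tS j; move: IHj; lra.
Qed.

(** The tail of the increments after step [j] is at most [2 t_j]. *)
Lemma fast_limit (x : nat -> V) (t : nat -> R) :
  (forall j, t j.+1 <= t j / 2) -> (forall j, rnorm (x j.+1 - x j) <= t j) ->
  exists l, forall j, rnorm (l - x j) <= 2 * t j.
Proof.
move=> tS xS.
have t_ge0 j : 0 <= t j by apply: le_trans (xS j); exact: rnorm_ge0.
have xjm j m : (j <= m)%N -> rnorm (x m - x j) <= 2 * t j.
  move=> /subnKC <-; apply: le_trans (fast_telescope _ _ tS xS) _.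
  by rewrite lerBlDr lerDl mulr_ge0.
have x_cvg : cvg (x @ \oo).
  apply/cauchy_cvgP/cauchy_exP => eps eps0.
  have [e e0 epsE] : exists2 e : R, 0 < e & eps = e%:C.
    exists (complex.Re eps); last by rewrite RRe_real// gtr0_real.
    by rewrite -ltcR RRe_real// gtr0_real.
  have [j tj] : exists j, 2 * t j < e.
    apply: contrapT => no_j; suff : e <= 0 by rewrite leNgt e0.
    apply: (@geometric_bound_le0 _ _ (2 * t 0%N)); first by rewrite mulr_ge0.
    move=> j; have : ~~ (2 * t j < e) by apply/negP => h; apply: no_j; exists j.
    rewrite -leNgt => /le_trans; apply; rewrite -mulrA ler_wpM2l//.
    exact: fast_le.
  exists (x j); exists j => // m /= jm.
  rewrite -ball_normE /ball_ /= epsE rnormE ltcR; apply: le_lt_trans tj.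
  by rewrite -rnormN opprB xjm.
exists (lim (x @ \oo)) => j.
apply/ler_addgt0Pr => e e0.
move/cvgrPdist_lt : x_cvg => /(_ e%:C); rewrite ltcR => /(_ e0) [m _ xm].
have := xm (maxn m j) (leq_maxl _ _); rewrite rnormE ltcR => lim_m.
rewrite -(subrKA (x (maxn m j))); apply: le_trans (rnormD _ _) _.
have := xjm j (maxn m j) (leq_maxr _ _); move: lim_m; lra.
Qed.

End Limits.

Section Cochains.
Variables (R : realType) (A : banachAlgType R[i]) (X : banachBimodType A).

Lemma multilinear_scale n (T : ('I_n -> A) -> X) (z : 'I_n -> R[i]) a : multilinear T ->
  T (fun i => z i *: a i) = (\prod_i z i) *: T a.
Proof.
move=> T_lin.
pose s k (i : 'I_n) := if (i < k)%N then z i *: a i else a i.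
suff step k : (k <= n)%N -> T (s k) = (\prod_(i < n | (i < k)%N) z i) *: T a.
  rewrite (_ : (fun i => _) = s n); last by apply: funext => i; rewrite /s ltn_ord.
  by rewrite step//; congr (_ *: _); apply: eq_bigl => i; rewrite ltn_ord.
elim: k => [_|k IHk kn].
  by rewrite big_pred0// scale1r; congr (T _); apply: funext.
pose k' := Ordinal kn.
have -> : s k.+1 = dfwith (s k) k' (z k' *: a k').
  apply: funext => i; rewrite dfwithE /s ltnS -val_eqE /=.
  by case: ltngtP => // ik; rewrite (_ : i = k')//; exact: val_inj.
rewrite (linfZ (T_lin k' (s k))).
rewrite (_ : dfwith (s k) k' (a k') = s k); last first.
  apply: funext => i; rewrite dfwithE /s -val_eqE /=.
  by case: ltngtP => // ik; rewrite (_ : i = k')//; exact: val_inj.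
have -> : \prod_(i < n | (i < k.+1)%N) z i = z k' * \prod_(i < n | (i < k)%N) z i.
  rewrite (bigD1 k') ?ltnSn//=; congr (_ * _).
  by apply: eq_bigl => i; rewrite -val_eqE /= ltnS; case: ltngtP.
by rewrite IHk 1?ltnW// scalerA.
Qed.

(** Reduction to the unit ball; a zero argument is kept, with factor zero. *)
Lemma normalize_args n (a : 'I_n -> A) : exists2 b, unit_ball_pow b &
  forall T : ('I_n -> A) -> X, multilinear T ->
    T a = (\prod_i rnorm (a i))%:C *: T b.
Proof.
exists (fun i => ((rnorm (a i))^-1)%:C *: a i) => [i|T T_lin].
  rewrite rnormZ cnorm_real ?invr_ge0 ?rnorm_ge0//.
  by have [->|a0] := eqVneq (rnorm (a i)) 0; rewrite ?mulr0// mulVf.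
rewrite rmorph_prod/= -multilinear_scale//; congr (T _); apply: funext => i.
have [a0|a0] := eqVneq (rnorm (a i)) 0.
  by rewrite (rnorm_eq0 a0) !scaler0.
by rewrite scalerA -rmorphM/= divff// scale1r.
Qed.

Lemma prod_rnorm_ge0 n (a : 'I_n -> A) : 0 <= \prod_i rnorm (a i).
Proof. by apply: prodr_ge0 => i _; exact: rnorm_ge0. Qed.

Lemma zero_in_ball n : @unit_ball_pow _ A n (fun=> 0).
Proof. by move=> i; rewrite rnorm0 ler01. Qed.

Lemma prod_ball_le1 n (a : 'I_n -> A) : unit_ball_pow a -> \prod_i rnorm (a i) <= 1.
Proof.
by move=> a1; apply: prodr_ile1 => i _; rewrite rnorm_ge0 a1.
Qed.

Lemma opnorm_ub n (T : ('I_n -> A) -> X) : bounded_maps X n T ->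
  has_ubound [set rnorm (T a) | a in @unit_ball_pow _ A n].
Proof.
move=> [_ [c T_bnd]]; exists `|c| => _ [a a1 <-].
apply: le_trans (T_bnd a) _; apply: le_trans (ler_norm _) _.
rewrite normrM (ger0_norm (prod_rnorm_ge0 a)) ler_piMr//.
exact: prod_ball_le1.
Qed.

Lemma rnorm_le_opnorm n (T : ('I_n -> A) -> X) a : bounded_maps X n T ->
  rnorm (T a) <= opnorm T * \prod_i rnorm (a i).
Proof.
move=> T_bm; have [b b1 ->//] := normalize_args a; last by case: T_bm.
rewrite rnormZ cnorm_real ?prod_rnorm_ge0// mulrC ler_wpM2r ?prod_rnorm_ge0//.
by apply: ub_le_sup; [exact: opnorm_ub|exists b].
Qed.

Lemma opnorm_le n (T : ('I_n -> A) -> X) c :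
  (forall a, unit_ball_pow a -> rnorm (T a) <= c) -> opnorm T <= c.
Proof.
move=> T_le; apply: ge_sup => [|_ [a a1 <-]]; last exact: T_le.
by exists (rnorm (T (fun=> 0))), (fun=> 0) => //; exact: zero_in_ball.
Qed.

Lemma opnorm_le_prod n (T : ('I_n -> A) -> X) c : 0 <= c ->
  (forall a, rnorm (T a) <= c * \prod_i rnorm (a i)) -> opnorm T <= c.
Proof.
move=> c0 T_le; apply: opnorm_le => a a1; apply: le_trans (T_le a) _.
by rewrite ler_piMr// prod_ball_le1.
Qed.

Lemma opnorm_ge0 n (T : ('I_n -> A) -> X) : bounded_maps X n T -> 0 <= opnorm T.
Proof.
move=> T_bm; apply: le_trans (rnorm_ge0 (T (fun=> 0))) _.
by apply: ub_le_sup; [exact: opnorm_ub|exists (fun=> 0) => //; exact: zero_in_ball].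
Qed.

Lemma bounded_maps_subspace n : real_subspace (bounded_maps X n).
Proof.
split.
  split; last by exists 0 => a; rewrite rnorm0 mul0r.
  by move=> i a c x y; rewrite scaler0 addr0.
move=> t S T [S_lin [c S_bnd]] [T_lin [d T_bnd]]; split.
  move=> i a z x y; rewrite !addrfctE !scalrfctE S_lin T_lin.
  rewrite !scalerDr !scalerA [t%:C * z]mulrC [LHS](AC (2*2) ((1*3)*(2*4))) /=.
  by [].
exists (`|t| * c + d) => a; apply: le_trans (rnormD _ _) _.
rewrite mulrDl lerD// -mulrA; apply: le_trans (_ : `|t| * rnorm (S a) <= _).
  by rewrite rnormZ /cnorm normc_def /= expr0n addr0 sqrtr_sqr.
by rewrite ler_wpM2l.
Qed.

Lemma opnorm_seminorm n : seminorm_on (bounded_maps X n) (@opnorm _ _ X n).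
Proof.
have cnormR (t : R) : cnorm t%:C = `|t|.
  by rewrite /cnorm normc_def /= expr0n addr0 sqrtr_sqr.
split=> [T|S T S_bm T_bm|t T T_bm]; first exact: opnorm_ge0.
  apply: opnorm_le_prod => [|a]; first by rewrite addr_ge0// opnorm_ge0.
  by apply: le_trans (rnormD _ _) _; rewrite mulrDl lerD// rnorm_le_opnorm.
apply/eqP; rewrite eq_le; apply/andP; split.
  apply: opnorm_le_prod => [|a]; first by rewrite mulr_ge0// opnorm_ge0.
  by rewrite rnormZ cnormR -mulrA ler_wpM2l// rnorm_le_opnorm.
have [->|t0] := eqVneq t 0.
  rewrite normr0 mul0r; apply: opnorm_ge0.
  by apply: (real_subspaceZ (bounded_maps_subspace n)).
rewrite mulrC -ler_pdivlMr ?normr_gt0//; apply: opnorm_le => a a1.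
rewrite ler_pdivlMr ?normr_gt0// mulrC -cnormR -rnormZ.
apply: ub_le_sup; last by exists a.
by apply: opnorm_ub; apply: (real_subspaceZ (bounded_maps_subspace n)).
Qed.

Lemma bounded_mapsB n (S T : ('I_n -> A) -> X) :
  bounded_maps X n S -> bounded_maps X n T -> bounded_maps X n (S - T).
Proof. exact: (real_subspaceB (bounded_maps_subspace n)). Qed.

Lemma opnorm_complete n : fast_complete (bounded_maps X n) (@opnorm _ _ X n).
Proof.
move=> T t T_bm tS TS.
have t_ge0 j : 0 <= t j.
  by apply: le_trans (TS j); apply: opnorm_ge0; exact: bounded_mapsB.
pose N (a : 'I_n -> A) := \prod_i rnorm (a i).
have N_ge0 a : 0 <= N a by exact: prod_rnorm_ge0.
have lim_ex a : exists l, forall j, rnorm (l - T j a) <= 2 * (t j * N a).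
  apply: (fast_limit (x := fun j => T j a)) => j; first by rewrite mulrAC ler_wpM2r.
  apply: le_trans (rnorm_le_opnorm a (bounded_mapsB (T_bm j.+1) (T_bm j))) _.
  by apply: ler_wpM2r; [exact: prod_rnorm_ge0|exact: TS].
have [U UT] := choice lim_ex.
exists U; last first.
  move=> j; apply: opnorm_le_prod => [|a]; first by rewrite mulr_ge0.
  by rewrite -mulrA; exact: UT.
split; last first.
  exists (2 * t 0%N + opnorm (T 0%N)) => a; rewrite -[U a](subrK (T 0%N a)).
  apply: le_trans (rnormD _ _) _; rewrite mulrDl lerD// -?mulrA//.
  exact: rnorm_le_opnorm.
move=> i a c x y; apply/eqP; rewrite -subr_eq0; apply/eqP/rnorm_eq0/eqP.
rewrite eq_le rnorm_ge0 andbT.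
pose Na := N (dfwith a i (c *: x + y)) + cnorm c * N (dfwith a i x) + N (dfwith a i y).
have Na_ge0 : 0 <= Na by rewrite !addr_ge0// mulr_ge0// cnorm_ge0.
apply: (@geometric_bound_le0 _ _ (2 * t 0%N * Na)); first by rewrite !mulr_ge0.
move=> j; apply: (@le_trans _ _ (2 * t j * Na)); last first.
  by rewrite [leRHS]mulrAC ler_wpM2r// -mulrA ler_wpM2l// fast_le.
have [T_lin _] := T_bm j.
rewrite (_ : _ - _ = (U (dfwith a i (c *: x + y)) - T j (dfwith a i (c *: x + y)))
   - c *: (U (dfwith a i x) - T j (dfwith a i x))
   - (U (dfwith a i y) - T j (dfwith a i y))); last first.
  rewrite T_lin scalerBr !opprD !opprK.
  by rewrite [RHS](AC ((1*2)*2*2) ((1*(4*6))*(5*2)*(7*3))) /= !subrr !addr0.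
apply: le_trans (rnormB _ _) _; apply: le_trans (lerD (rnormB _ _) (UT _ j)) _.
apply: le_trans (lerD (lerD (UT _ j) (lexx _)) (lexx _)) _.
rewrite rnormZ; have := ler_wpM2l (cnorm_ge0 c) (UT (dfwith a i x) j).
rewrite /Na; lra.
Qed.

Lemma connecting_bm n (T : ('I_n -> A) -> X) :
  bounded_maps X n T -> bounded_maps X n.+1 (connecting T).
Proof.
move=> T_bm; split; first by apply: multilinear_connecting; case: T_bm.
exists (n.+2%:R * opnorm T) => a; apply: rnorm_connecting; first by case: T_bm.
  by move=> b; exact: rnorm_le_opnorm.
exact: opnorm_ge0.
Qed.

Lemma opnorm_connecting n (T : ('I_n -> A) -> X) :
  bounded_maps X n T -> opnorm (connecting T) <= n.+2%:R * opnorm T.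
Proof.
move=> T_bm; apply: opnorm_le_prod; first by rewrite mulr_ge0// opnorm_ge0.
move=> a; apply: rnorm_connecting; first by case: T_bm.
  by move=> b; exact: rnorm_le_opnorm.
exact: opnorm_ge0.
Qed.

Lemma connecting_linear n : linear (@connecting _ _ X n).
Proof.
move=> c S T; apply: funext => a.
have E b : (c *: S + T) b = c *: S b + T b by [].
rewrite -[RHS]/(c *: connecting S a + connecting T a) /connecting !E.
rewrite lact_linr ract_linl.
under eq_bigr => j _ do rewrite E scalerDr scalerA mulrC -scalerA.
rewrite big_split /= -scaler_sumr !scalerDr !scalerA [c * _]mulrC.
by rewrite [LHS](AC (2*2*2) ((1*3*5)*(2*4*6))).
Qed.

Lemma cocycle0 n : cocycles X n 0.
Proof.
split; first exact: (bounded_maps_subspace n).1.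
by move=> a; rewrite (linf0 (@connecting_linear n)).
Qed.

Lemma has_lbound_dist n (T : ('I_n -> A) -> X) (S : set (('I_n -> A) -> X)) :
  bounded_maps X n T -> S `<=` bounded_maps X n ->
  has_lbound [set opnorm (T \- s) | s in S].
Proof.
by move=> T_bm S_bm; exists 0 => _ [s /S_bm s_bm <-]; apply: opnorm_ge0; exact: bounded_mapsB.
Qed.

Lemma inf_le_dist_r n (T : ('I_n -> A) -> X) a : bounded_maps X n T ->
  unit_ball_pow a ->
  inf [set rnorm (T a - s a) | s in cocycles X n] <= dist_r T (cocycles X n).
Proof.
move=> T_bm a1; apply: ub_le_sup; last by exists a.
exists (opnorm T) => _ [b b1 <-].
apply: (@le_trans _ _ (rnorm (T b - 0))).
  apply: ge_inf; first by exists 0 => _ [s _ <-]; exact: rnorm_ge0.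
  by exists 0 => //; exact: cocycle0.
rewrite subr0; apply: ub_le_sup; first exact: opnorm_ub.
by exists b.
Qed.

(** The defining supremum of [dist_r] runs over the unit ball; homogeneity
    gives the estimate for all arguments. *)
Lemma dist_near n (T : ('I_n -> A) -> X) a eps : bounded_maps X n T -> 0 < eps ->
  exists2 S, cocycles X n S &
    rnorm (T a - S a) <= dist_r T (cocycles X n) * \prod_i rnorm (a i) + eps.
Proof.
move=> T_bm eps0; have [b b1 ab] := normalize_args a.
set N := \prod_i rnorm (a i) in ab *.
have N_ge0 : 0 <= N by exact: prod_rnorm_ge0.
pose E (a : 'I_n -> A) := [set rnorm (T a - s a) | s in cocycles X n].
have E_inf a' : has_inf (E a').
  split; first by exists (rnorm (T a' - 0)), 0 => //; exact: cocycle0.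
  by exists 0 => _ [s _ <-]; exact: rnorm_ge0.
have E_le := inf_le_dist_r T_bm b1.
have d_gt0 : 0 < eps / (N + 1) by rewrite divr_gt0// ltr_wpDl.
have [_ [S Sc <-] TSb] := inf_adherent d_gt0 (E_inf b).
exists S => //; rewrite !ab; [|by case: Sc => -[]|by case: T_bm].
rewrite -scalerBr rnormZ cnorm_real//.
apply: (@le_trans _ _ (N * (dist_r T (cocycles X n) + eps / (N + 1)))).
  by rewrite ler_wpM2l// ltW// (lt_le_trans TSb)// lerD2r.
rewrite mulrDr mulrC lerD2l mulrCA ler_piMr ?(ltW eps0)//.
by rewrite ler_pdivrMr ?mul1r ?lerDl// ltr_wpDl.
Qed.

Lemma dist_r_ge0 n (T : ('I_n -> A) -> X) :
  bounded_maps X n T -> 0 <= dist_r T (cocycles X n).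
Proof.
move=> T_bm; apply: le_trans (inf_le_dist_r T_bm (@zero_in_ball n)).
apply: lb_le_inf => [|_ [s _ <-]]; last exact: rnorm_ge0.
by exists (rnorm (T (fun=> 0) - 0)), 0 => //; exact: cocycle0.
Qed.

Lemma dist_r_cocycle n (T : ('I_n -> A) -> X) :
  cocycles X n T -> dist_r T (cocycles X n) = 0.
Proof.
move=> Tc; apply/eqP; rewrite eq_le dist_r_ge0 ?andbT; last by case: Tc.
apply: ge_sup.
  by eexists; exists (fun=> 0); [exact: zero_in_ball|reflexivity].
move=> _ [a _ <-]; apply: ge_inf; first by exists 0 => _ [s _ <-]; exact: rnorm_ge0.
by exists T => //; rewrite subrr rnorm0.
Qed.

Lemma dist_le n (T S : ('I_n -> A) -> X) :
  bounded_maps X n T -> cocycles X n S -> dist T (cocycles X n) <= opnorm (T \- S).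
Proof.
move=> T_bm Sc; apply: ge_inf; last by exists S.
by apply: has_lbound_dist => // s [].
Qed.

Lemma dist_ge0 n (T : ('I_n -> A) -> X) :
  bounded_maps X n T -> 0 <= dist T (cocycles X n).
Proof.
move=> T_bm; apply: lb_le_inf => [|_ [s [s_bm _] <-]].
  by exists (opnorm (T \- 0)), 0 => //; exact: cocycle0.
by apply: opnorm_ge0; exact: bounded_mapsB.
Qed.

Lemma opnorm_eq0 n (T : ('I_n -> A) -> X) a :
  bounded_maps X n T -> opnorm T = 0 -> T a = 0.
Proof.
move=> T_bm T0; apply/rnorm_eq0/eqP; rewrite eq_le rnorm_ge0 andbT.
by have := rnorm_le_opnorm a T_bm; rewrite T0 mul0r.
Qed.

(** * Closed image and the stability constant *)

Lemma connecting_seminorm n :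
  seminorm_on (bounded_maps X n) (fun T => opnorm (connecting T)).
Proof.
have [p0 pD pZ] := opnorm_seminorm n.+1.
split=> [T T_bm|S T S_bm T_bm|t T T_bm].
- exact/p0/connecting_bm.
- by rewrite (linfD (@connecting_linear n)); apply: pD; exact: connecting_bm.
- by rewrite (linfZ (@connecting_linear n)); apply: pZ; exact: connecting_bm.
Qed.

(** The limit is a cocycle since [connecting] is continuous and vanishes on
    coboundaries, and its class has seminorm zero. *)
Lemma coboundary_limit n (y : ('I_n.+1 -> A) -> X) (T : nat -> ('I_n -> A) -> X) t :
  cohomology_banach X n -> bounded_maps X n.+1 y ->
  (forall j, bounded_maps X n (T j)) -> (forall j, t j.+1 <= t j / 2) ->
  (forall j, opnorm (y - connecting (T j)) <= 2 * t j) -> coboundaries X n y.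
Proof.
move=> [closed_im _] y_bm T_bm tS yT.
have dT_bm j : bounded_maps X n.+1 (connecting (T j)) by exact: connecting_bm.
have yT_bm j : bounded_maps X n.+1 (y - connecting (T j)) by exact: bounded_mapsB.
have t_ge0 : 0 <= t 0%N.
  by rewrite -(pmulr_rge0 _ (ltr0n R 2)) (le_trans _ (yT 0%N))// opnorm_ge0.
apply: closed_im.
  split=> // a; apply/rnorm_eq0/eqP; rewrite eq_le rnorm_ge0 andbT.
  apply: (@geometric_bound_le0 _ _ (n.+3%:R * (2 * t 0%N) * \prod_i rnorm (a i))).
    by rewrite !mulr_ge0// prod_rnorm_ge0.
  move=> j; rewrite (_ : connecting y a = connecting (y - connecting (T j)) a); last first.
    rewrite (linfB (@connecting_linear n.+1)).
    rewrite -[RHS]/(connecting y a - connecting (connecting (T j)) a).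
    have [T_lin _] := T_bm j.
    by rewrite connecting_connecting ?subr0//; exact: multilinear_connecting.
  apply: le_trans (rnorm_le_opnorm a (connecting_bm (yT_bm j))) _.
  rewrite [leRHS]mulrAC; apply: ler_wpM2r; first exact: prod_rnorm_ge0.
  apply: le_trans (opnorm_connecting (yT_bm j)) _.
  rewrite -mulrA ler_wpM2l// (le_trans (yT j))// -mulrA ler_wpM2l//.
  exact: fast_le.
apply/eqP; rewrite eq_le; apply/andP; split.
  apply: (@geometric_bound_le0 _ _ (2 * t 0%N)); first by rewrite mulr_ge0.
  move=> j; apply: (@le_trans _ _ (opnorm (y - connecting (T j)))).
    apply: ge_inf; last by exists (connecting (T j)) => //; exists (T j).
    by apply: has_lbound_dist => // _ [S S_bm <-]; exact: connecting_bm.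
  by rewrite (le_trans (yT j))// -mulrA ler_wpM2l// fast_le.
apply: lb_le_inf.
  by eexists; exists (connecting (T 0%N)); [exists (T 0%N)|reflexivity].
move=> _ [_ [S S_bm <-] <-]; apply: opnorm_ge0; apply: bounded_mapsB => //.
exact: connecting_bm.
Qed.

Lemma connecting_complete n : cohomology_banach X n ->
  fast_complete (bounded_maps X n) (fun T => opnorm (connecting T)).
Proof.
move=> H T t T_bm tS TS.
have dB := linfB (@connecting_linear n).
have [||| y y_bm yT] := @opnorm_complete n.+1 (fun j => connecting (T j)) t.
- by move=> j; exact: connecting_bm.
- exact: tS.
- by move=> j; rewrite -dB; exact: TS.
have [S S_bm Sy] := coboundary_limit H y_bm T_bm tS yT.
by exists S => // j; rewrite dB Sy.
Qed.

Lemma stability_constant_exists n : cohomology_banach X n ->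
  exists C, stability_constant X n C.
Proof.
move=> H; have [C C0 lift] := open_mapping (bounded_maps_subspace n)
  (opnorm_seminorm n) (connecting_seminorm n) (@opnorm_complete n)
  (connecting_complete H) (@opnorm_connecting n).
exists C => T T_bm; have [u [u_bm su pu]] := lift T T_bm.
have Tu_bm := bounded_mapsB T_bm u_bm.
have Tu : cocycles X n (T - u).
  by split=> // a; apply: opnorm_eq0 => //; exact: connecting_bm.
apply: le_trans (dist_le T_bm Tu) _.
by rewrite (_ : T \- (T - u) = u)//; apply: funext => a; rewrite /= opprB addrC subrK.
Qed.

End Cochains.

Lemma opnorm_connecting_le_dist_r (R : realType) (A : banachAlgType R[i]) (M r : R)
    (X : banachBimodType A) n (T : ('I_n -> A) -> X) :
  bounded_local_units A M -> strong_property_B A r -> bounded_maps X n T ->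
  opnorm (connecting T) <= gap_constant M r ^+ n.+1 * dist_r T (cocycles X n).
Proof.
move=> units_A B_A T_bm; have K0 := gap_constant_ge0 units_A B_A.
apply: opnorm_le_prod => [|a]; first by rewrite mulr_ge0 ?exprn_ge0 ?dist_r_ge0.
apply: (rnorm_connecting_le units_A B_A) => // [|b eps eps0]; first exact: dist_r_ge0.
exact: dist_near.
Qed.

Theorem theorem4p3 (R : realType) (A : banachAlgType R[i]) (M r : R)
    (units_A : bounded_local_units A M) (B_A : strong_property_B A r)
    (n : nat) (n_gt0 : (0 < n)%N) (X : banachBimodType A)
    (banach_H : cohomology_banach X n) :
  (exists C : R, stability_constant X n C) /\
  (forall C : R, stability_constant X n C ->
     forall T : ('I_n -> A) -> X, bounded_maps X n T ->
       dist T (cocycles X n) <=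
         C * 2 ^+ (n - 1) * (M ^+ 2 * r + (M + 1) ^+ 2) ^+ (n + 1) *
         dist_r T (cocycles X n)).
Proof.
split=> [|C C_stable T T_bm]; first exact: stability_constant_exists.
rewrite -/(gap_constant M r) addn1.
have dT := C_stable T T_bm; have dT_ge0 := opnorm_ge0 (connecting_bm T_bm).
have [C0|C0] := leP 0 C.
  apply: le_trans dT _; rewrite -!mulrA ler_wpM2l//.
  apply: le_trans (opnorm_connecting_le_dist_r units_A B_A T_bm) _.
  rewrite ler_peMl ?exprn_ege1 ?ler1n// mulr_ge0 ?dist_r_ge0// exprn_ge0//.
  exact: gap_constant_ge0 units_A B_A.
(* For negative [C] the hypothesis forces [connecting T = 0]. *)
have dT0 : opnorm (connecting T) = 0.
  apply/eqP; rewrite eq_le dT_ge0 andbT.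
  by rewrite -(nmulr_rge0 _ C0) (le_trans (dist_ge0 T_bm)).
have Tc : cocycles X n T.
  by split=> // a; apply: opnorm_eq0 => //; exact: connecting_bm.
by rewrite dist_r_cocycle// mulr0 (le_trans dT)// dT0 mulr0.
Qed.
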